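(* Let $\mathcal{B}(\Omega)$ be a Bergman-type space with Rudin–Forelli constant $\kappa$. Let $T$ be a linear operator defined a priori only on the linear span of the normalized reproducing kernels $\{k_z\}$ of $\mathcal{B}(\Omega)$, and assume there is a linear operator $T^*$ defined on the same span such that $\langle Tk_z,k_w\rangle=\langle k_z,T^*k_w\rangle$ for all $z,w\in\Omega$. If for some $p>\frac{4-\kappa}{2-\kappa}$ $$\sup_{z\in\Omega}\|U_zTk_z\|_{L^p(\Omega;d\sigma)}<\infty\quad\text{and}\quad\sup_{z\in\Omega}\|U_zT^*k_z\|_{L^p(\Omega;d\sigma)}<\infty,$$ then $T$ extends to a bounded operator on $\mathcal{B}(\Omega)$.
   Context: Notation: $A\lesssim B$ means $A\le CB$ for a constant $C$ independent of the relevant variables; $A\simeq B$ means $A\lesssim B$ and $B\lesssim A$. Bergman-type space: $\Omega\subset\mathbb{C}^n$ is a domain containing $0$ such that: (A.1) for each $z\in\Omega$ there is an involutive biholomorphic automorphism $\varphi_z$ of $\Omega$ with $\varphi_z(0)=z$; (A.2) there is a metric $d$ on $\Omega$ with $d(u,v)\simeq d(\varphi_z(u),\varphi_z(v))$ uniformly in $u,v,z$; $(\Omega,d)$ is separable and every closed $d$-ball is compact; $D(z,r)$ denotes the $d$-ball of center $z$ and radius $r$; (A.3) $\sigma$ is a finite Borel measure on $\Omega$, $\mathcal{B}(\Omega)$ is the space of holomorphic functions on $\Omega$ lying in $L^2(\Omega;d\sigma)$ with the $L^2(\sigma)$ norm $\|\cdot\|$ and inner product $\langle\cdot,\cdot\rangle$;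 $\mathcal{B}(\Omega)$ is a reproducing kernel Hilbert space with reproducing kernel $K_z$ ($f(z)=\langle f,K_z\rangle$) and normalized kernel $k_z=K_z/\|K_z\|$; $z\mapsto\|K_z\|$ is continuous on $(\Omega,d)$; (A.4) the measure $d\lambda(z):=\|K_z\|^2d\sigma(z)$ satisfies $\lambda(E)\simeq\lambda(\varphi_z(E))$ for Borel $E$, uniformly in $z$, and is doubling: $\lambda(D(z,2r))\le C\lambda(D(z,r))$ for all $z,r>0$; (A.5) $|\langle k_z,k_w\rangle|\simeq 1/\|K_{\varphi_z(w)}\|$ uniformly in $z,w$; (A.6) (Rudin–Forelli estimates) there is a constant $\kappa\in[0,2)$ such that, if $\kappa>0$, for all $r>\kappa>s>0$ one has $\sup_{z\in\Omega}\int_\Omega \frac{|\langle K_z,K_w\rangle|^{(r+s)/2}}{\|K_z\|^s\|K_w\|^r}d\lambda(w)<\infty$, and if $\kappa=0$ this holds for all $r=s>0$; (A.7) $\|K_z\|\to\infty$ as $d(z,0)\to\infty$. Translation operators: $U_zf(w):=f(\varphi_z(w))k_z(w)$ for $z\in\Omega$. *)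

(* Defs.v *)
(* MathComp + MathComp-Analysis (R : realType), complex numbers R[i]
   from mathcomp-real-closed.  C^n is modelled as row vectors 'rV[R[i]]_n. *)
From HB Require Import structures.
From mathcomp Require Import all_boot all_order all_algebra.
From mathcomp Require Import all_classical all_reals all_analysis.
From mathcomp Require Import complex.

Set Implicit Arguments.
Unset Strict Implicit.
Unset Printing Implicit Defensive.

Import Order.TTheory GRing.Theory Num.Theory.
Local Open Scope classical_set_scope.
Local Open Scope ring_scope.

(* The space C^n                                                        *)

Definition Cn (R : realType) (n : nat) : Type := 'rV[R[i]]_n.

HB.instance Definition _ (R : realType) (n : nat) :=
  Choice.copy (Cn R n) 'rV[R[i]]_n.
HB.instance Definition _ (R : realType) (n : nat) :=
  isPointed.Build (Cn R n) 0.

(* modulus of a complex number *)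
Definition cabs (R : realType) (z : R[i]) : R :=
  Num.sqrt (complex.Re z ^+ 2 + complex.Im z ^+ 2).

Section Defs.
Variables (R : realType) (n : nat).
Local Notation C := (R[i]).
Local Notation V := (Cn R n).

(* Euclidean norm on C^n *)
Definition vnorm (h : V) : R :=
  Num.sqrt (\sum_(j < n) (cabs (h ord0 j)) ^+ 2).

(* Euclidean open sets of C^n *)
Definition Copen (A : set V) : Prop :=
  forall x, A x -> exists2 e : R, 0 < e & forall y, vnorm (y - x) < e -> A y.

(* A domain: a nonempty connected open set *)
Definition Cconnected (A : set V) : Prop :=
  forall U W : set V, Copen U -> Copen W -> U `&` W `&` A = set0 ->
    A `<=` U `|` W -> A `&` U = set0 \/ A `&` W = set0.

Definition Cdomain (A : set V) : Prop :=
  Copen A /\ A !=set0 /\ Cconnected A.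

(* Holomorphy (complex Frechet differentiability at every point of Om)
   of a scalar function, and of a C^n-valued map (coordinatewise). *)
Definition holo_on (Om : set V) (f : V -> C) : Prop :=
  forall z, Om z -> exists a : 'rV[C]_n, forall e : R, 0 < e ->
    exists2 delta : R, 0 < delta & forall h : V, vnorm h < delta ->
      cabs (f (z + h) - f z - \sum_(j < n) a ord0 j * h ord0 j)
        <= e * vnorm h.

Definition holo_map_on (Om : set V) (F : V -> V) : Prop :=
  forall j : 'I_n, holo_on Om (fun w => F w ord0 j).

(* The Borel sigma-algebra of C^n *)
Definition CBorel := g_sigma_algebraType (Copen : set (set V)).

(* L^2 quantities with respect to a measure sigma on C^n                *)
Variable sigma : {measure set CBorel -> \bar R}.

(* complex-valued integral over a set D *)
Definition cintegral (D : set V) (h : V -> C) : C :=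
  Complex (Rintegral sigma D (fun x => complex.Re (h x))) (Rintegral sigma D (fun x => complex.Im (h x))).

(* L^2 inner product and norm over Om *)
Definition inner (Om : set V) (f g : V -> C) : C :=
  cintegral Om (fun x => f x * (g x)^*).

Definition L2norm (Om : set V) (f : V -> C) : R :=
  Num.sqrt (fine (\int[sigma]_(x in Om) ((cabs (f x)) ^+ 2)%:E)%E).

(* The space B(Om): holomorphic functions on Om lying in L^2(Om; sigma).
   Functions are extended by 0 outside Om, so that equality of elements
   of B(Om) is plain equality of functions. *)
Definition Bspace (Om : set V) (f : V -> C) : Prop :=
  holo_on Om f /\ (forall w, ~ Om w -> f w = 0) /\
  (\int[sigma]_(x in Om) ((cabs (f x)) ^+ 2)%:E < +oo)%E.

(* K : z |-> K_z is the reproducing kernel of B(Om) *)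
Definition reproducing_kernel (Om : set V) (K : V -> V -> C) : Prop :=
  (forall z, Om z -> Bspace Om (K z)) /\
  (forall f, Bspace Om f -> forall z, Om z -> f z = inner Om f (K z)).

(* B(Om) is complete for the L^2 norm (Hilbert space) *)
Definition Bcomplete (Om : set V) : Prop :=
  forall u : nat -> V -> C, (forall k, Bspace Om (u k)) ->
    (forall e : R, 0 < e -> exists N, forall k l, (N <= k)%N -> (N <= l)%N ->
        L2norm Om (u k \- u l) < e) ->
    exists2 f, Bspace Om f &
      forall e : R, 0 < e -> exists N, forall k, (N <= k)%N ->
        L2norm Om (u k \- f) < e.

Definition Knorm (Om : set V) (K : V -> V -> C) (z : V) : R := L2norm Om (K z).

(* normalized kernel k_z *)
Definition nkernel (Om : set V) (K : V -> V -> C) (z : V) : V -> C :=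
  fun w => K z w / Complex (Knorm Om K z) 0.

(* the measure d lambda = ||K_z||^2 d sigma *)
Definition lambda (Om : set V) (K : V -> V -> C) (E : set V) : \bar R :=
  (\int[sigma]_(x in E) ((Knorm Om K x) ^+ 2)%:E)%E.

(* the linear span of the normalized kernels {k_z : z in Om} *)
Definition kspan (Om : set V) (K : V -> V -> C) (f : V -> C) : Prop :=
  exists s : seq (C * V), (forall x, x \in s -> Om x.2) /\
    f = (fun w => \sum_(x <- s) x.1 * nkernel Om K x.2 w).

(* translation operators U_z f (w) = f(phi_z(w)) k_z(w) *)
Definition transl (Om : set V) (K : V -> V -> C) (phi : V -> V -> V)
  (z : V) (f : V -> C) : V -> C :=
  fun w => f (phi z w) * nkernel Om K z w.

End Defs.

(* Metric notions for (Om, d)                                           *)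
Section Metric.
Variables (R : realType) (T : Type).
Variables (Om : set T) (d : T -> T -> R).

Definition is_metric_on : Prop :=
  (forall x y, Om x -> Om y -> 0 <= d x y) /\
  (forall x y, Om x -> Om y -> d x y = 0 <-> x = y) /\
  (forall x y, Om x -> Om y -> d x y = d y x) /\
  (forall x y z, Om x -> Om y -> Om z -> d x z <= d x y + d y z).

(* open d-ball D(z,r) and closed d-ball *)
Definition dball (z : T) (r : R) : set T := [set w | Om w /\ d z w < r].
Definition cdball (z : T) (r : R) : set T := [set w | Om w /\ d z w <= r].

Definition dopen (U : set T) : Prop :=
  U `<=` Om /\ forall x, U x -> exists2 e : R, 0 < e & dball x e `<=` U.

Definition dcompact (A : set T) : Prop :=
  A `<=` Om /\
  forall F : set (set T), (forall U, F U -> dopen U) ->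
    (forall x, A x -> exists2 U, F U & U x) ->
    exists s : seq (set T), (forall U, U \in s -> F U) /\
      (forall x, A x -> exists2 U, U \in s & U x).

Definition dseparable : Prop :=
  exists D : nat -> T, (forall k, Om (D k)) /\
    forall x, Om x -> forall e : R, 0 < e -> exists k, d x (D k) < e.

End Metric.

(* Bergman-type spaces: conditions (A.1)-(A.7)                          *)
Section Bergman.
Variables (R : realType) (n : nat).
Local Notation V := (Cn R n).
Local Notation C := (R[i]).
Local Open Scope ereal_scope.

Definition bergman_type (Om : set V) (phi : V -> V -> V) (d : V -> V -> R)
  (sigma : {measure set CBorel R n -> \bar R}) (K : V -> V -> C) (kappa : R) : Prop :=
  let KN := Knorm sigma Om K in
  let k := nkernel sigma Om K in
  let lam := lambda sigma Om K in
  (* Om is a domain containing 0 *)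
  Cdomain Om /\ Om 0%R /\
  (* (A.1) involutive biholomorphic automorphisms phi_z with phi_z(0) = z *)
  (forall z, Om z ->
     (forall w, Om w -> Om (phi z w)) /\
     (forall w, Om w -> phi z (phi z w) = w) /\
     holo_map_on Om (phi z) /\
     phi z 0%R = z) /\
  (* (A.2) the metric d *)
  is_metric_on Om d /\
  (exists c : R, forall z u v, Om z -> Om u -> Om v ->
     (d u v <= c * d (phi z u) (phi z v))%R /\
     (d (phi z u) (phi z v) <= c * d u v)%R) /\
  dseparable Om d /\
  (forall z (r : R), Om z -> dcompact Om d (cdball Om d z r)) /\
  (* (A.3) sigma finite Borel measure on Om; B(Om) is a RKHS with kernel K *)
  sigma (~` Om) = 0 /\ sigma setT < +oo /\
  reproducing_kernel sigma Om K /\ Bcomplete sigma Om /\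
  (forall z, Om z -> forall e : R, (0 < e)%R -> exists2 delta : R, (0 < delta)%R &
     forall w, Om w -> (d z w < delta)%R -> (`|KN w - KN z| < e)%R) /\
  (* (A.4) lambda is quasi-invariant under phi_z and doubling *)
  (exists c : R, forall z (E : set V), Om z -> measurable (E : set (CBorel R n)) ->
     E `<=` Om ->
     lam E <= c%:E * lam (phi z @` E) /\ lam (phi z @` E) <= c%:E * lam E) /\
  (exists c : R, forall z (r : R), Om z -> (0 < r)%R ->
     lam (dball Om d z (2 * r)) <= c%:E * lam (dball Om d z r)) /\
  (* (A.5) *)
  (exists c : R, forall z w, Om z -> Om w ->
     (cabs (inner sigma Om (k z) (k w)) <= c / KN (phi z w))%R /\
     ((KN (phi z w))^-1 <= c * cabs (inner sigma Om (k z) (k w)))%R) /\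
  (* (A.6) Rudin--Forelli estimates with constant kappa in [0,2) *)
  (0 <= kappa)%R /\ (kappa < 2)%R /\
  (let RF (r s : R) := exists M : R, forall z, Om z ->
      \int[sigma]_(w in Om)
        ((cabs (inner sigma Om (K z) (K w)) `^ ((r + s) / 2)
           / (KN z `^ s * KN w `^ r)) * KN w ^+ 2)%:E <= M%:E in
   ((0 < kappa)%R -> forall r s : R, (kappa < r)%R -> (0 < s)%R -> (s < kappa)%R -> RF r s) /\
   (kappa = 0%R -> forall r : R, (0 < r)%R -> RF r r)) /\
  (* (A.7) ||K_z|| -> oo as d(z,0) -> oo *)
  (forall M : R, exists N : R, forall z, Om z -> (N < d z 0%R)%R -> (M < KN z)%R).

End Bergman.

(* Main.v *)
(* The extension is [S f z = <f, T* K_z>], an integral operator on [L^2(sigma)]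
   with kernel [|T* K_z (w)| = |T K_w (z)|], and boundedness is Schur's test
   with weight [||K_w||^a].  With [q] dual to [p], [gam = 2 - q] and
   [a = 1 - beta / q], the bound on [U_z T* k_z] in [L^p(sigma)] becomes, by one
   change of variables [w -> phi_z w] and (A.5), a bound on [T* k_z] in
   [L^p] for the weight [||K_w||^(2-p) |<k_z,k_w>|^(2-p)].  Hoelder's inequality
   then leaves the integral of [|<k_z,k_w>|^gam ||K_w||^(-beta)] against
   [lambda], which is the Rudin-Forelli integral with [r = gam + beta],
   [s = gam - beta]; an admissible [beta] exists because
   [p > (4 - kappa) / (2 - kappa)] means [gam > kappa / 2].
   Finally [S f] is holomorphic because the kernels span a dense subspace. *)
Require Import Defs.
From HB Require Import structures.
From mathcomp Require Import all_boot all_order all_algebra.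
From mathcomp Require Import all_classical all_reals all_analysis.
From mathcomp Require Import measurable_realfun complex.
From mathcomp Require Import ring lra.

Set Implicit Arguments.
Unset Strict Implicit.
Unset Printing Implicit Defensive.

Import Order.TTheory GRing.Theory Num.Theory.
Local Open Scope classical_set_scope.
Local Open Scope ring_scope.

(** The kernel is not symmetric, which is why both suprema are assumed: Schur's test asks for
    integral bounds in each variable with the same weight, and [Tstar] supplies those in w, [T]
    those in z. The formula for S f makes sense for every f at once, but nothing says a priori that
    its values form a holomorphic function. The L^2 bound is therefore proved for functions already
    known to lie in B(Om), used on T g with g in the span, carried to limits by density and
    completeness, and only then applied to S f. Much of the remaining work is measurability.
    Tonelli's theorem needs a jointly measurable kernel, while the kernel is only known to be
    regular in each variable separately. The change of variables has no Jacobian at its disposal,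
    only the comparability of lambda on sets, so it passes through simple functions. Negative powers
    of ||K_w|| and |<k_z,k_w>| are legitimate because the constant 1 lies in B(Om) and because (A.5)
    bounds |<k_z,k_w>| from below. *)

(** * Modulus, real part and imaginary part of complex numbers *)

Section Modulus.
Variable R : realType.
Implicit Types x y : R[i].

Lemma cabs_normc x : cabs x = ComplexField.Normc.normc x.
Proof. by case: x. Qed.

Lemma cabs_ge0 x : 0 <= cabs x.
Proof. exact: sqrtr_ge0. Qed.

Lemma cabsM x y : cabs (x * y) = cabs x * cabs y.
Proof. by rewrite !cabs_normc ComplexField.Normc.normcM. Qed.

Lemma cabsV x : cabs x^-1 = (cabs x)^-1.
Proof. by rewrite !cabs_normc ComplexField.Normc.normcV. Qed.

Lemma cabs0 : cabs (0 : R[i]) = 0.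
Proof. by rewrite cabs_normc ComplexField.Normc.normc0. Qed.

Lemma cabs1 : cabs (1 : R[i]) = 1.
Proof. by rewrite cabs_normc ComplexField.Normc.normc1. Qed.

Lemma cabs_eq0 x : cabs x = 0 -> x = 0.
Proof. by rewrite cabs_normc; exact: ComplexField.Normc.eq0_normc. Qed.

Lemma ler_cabsD x y : cabs (x + y) <= cabs x + cabs y.
Proof. by rewrite !cabs_normc; exact: le_normcD. Qed.

Lemma cabsN x : cabs (- x) = cabs x.
Proof. by rewrite !cabs_normc normcN. Qed.

Lemma cabs_real (r : R) : 0 <= r -> cabs (Complex r 0) = r.
Proof. by move=> r0; rewrite /cabs /= expr0n addr0 sqrtr_sqr ger0_norm. Qed.

Lemma sqr_cabs x : cabs x ^+ 2 = complex.Re x ^+ 2 + complex.Im x ^+ 2.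
Proof. by rewrite sqr_sqrtr// addr_ge0 ?sqr_ge0. Qed.

Lemma cabs_conj x : cabs x^* = cabs x.
Proof. by case: x => a b; rewrite /cabs /= sqrrN. Qed.

Lemma conjRe x : complex.Re x^* = complex.Re x. Proof. by case: x. Qed.
Lemma conjIm x : complex.Im x^* = - complex.Im x. Proof. by case: x. Qed.

Lemma ReD x y : complex.Re (x + y) = complex.Re x + complex.Re y.
Proof. by case: x; case: y. Qed.
Lemma ImD x y : complex.Im (x + y) = complex.Im x + complex.Im y.
Proof. by case: x; case: y. Qed.
Lemma ReN x : complex.Re (- x) = - complex.Re x. Proof. by case: x. Qed.
Lemma ImN x : complex.Im (- x) = - complex.Im x. Proof. by case: x. Qed.
Lemma ReM x y : complex.Re (x * y) =
  complex.Re x * complex.Re y - complex.Im x * complex.Im y.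
Proof. by case: x; case: y. Qed.
Lemma ImM x y : complex.Im (x * y) =
  complex.Re x * complex.Im y + complex.Im x * complex.Re y.
Proof. by case: x => a b; case: y => c d /=; rewrite [b * c]mulrC. Qed.

Lemma complexP x y : complex.Re x = complex.Re y ->
  complex.Im x = complex.Im y -> x = y.
Proof. by case: x => a b; case: y => c d /= -> ->. Qed.

Lemma ler_Re_cabs x : `|complex.Re x| <= cabs x.
Proof. by rewrite -sqrtr_sqr /cabs ler_wsqrtr// lerDl sqr_ge0. Qed.

Lemma ler_Im_cabs x : `|complex.Im x| <= cabs x.
Proof. by rewrite -sqrtr_sqr /cabs ler_wsqrtr// lerDr sqr_ge0. Qed.

Lemma cabs_le_ReIm x : cabs x <= `|complex.Re x| + `|complex.Im x|.
Proof.
rewrite -[leRHS]ger0_norm ?addr_ge0// -sqrtr_sqr ler_wsqrtr// sqrrD.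
rewrite !real_normK ?num_real// lerD2r lerDl mulrn_wge0// mulr_ge0//.
Qed.

Lemma ler_dist_cabs x y : `|cabs x - cabs y| <= cabs (x - y).
Proof.
have h (a b : R[i]) : cabs a - cabs b <= cabs (a - b).
  by rewrite lerBlDr -{1}[a](subrK b) ler_cabsD.
by rewrite ler_norml h andbT lerNl opprB (le_trans (h _ _))// -cabsN opprB.
Qed.

Lemma ler_cabs_sum (I : Type) (s : seq I) (F : I -> R[i]) :
  cabs (\sum_(i <- s) F i) <= \sum_(i <- s) cabs (F i).
Proof.
elim/big_ind2: _ => [|x1 x2 y1 y2 h1 h2|//]; first by rewrite cabs0.
by rewrite (le_trans (ler_cabsD _ _))// lerD.
Qed.

End Modulus.

(** * Euclidean topology of C^n and Borel measurability of holomorphic functions *)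

Section EuclideanTopology.
Variables (R : realType) (n : nat).
Local Notation V := (Cn R n).
Local Notation B := (CBorel R n).
Implicit Types (U Om : set V).

Lemma vnorm_ge0 (h : V) : 0 <= vnorm h. Proof. exact: sqrtr_ge0. Qed.

Lemma cabs_le_vnorm (h : V) j : cabs (h ord0 j) <= vnorm h.
Proof.
rewrite -[leLHS]ger0_norm ?cabs_ge0// -sqrtr_sqr ler_wsqrtr//.
by rewrite (bigD1 j)//= lerDl sumr_ge0// => i _; rewrite sqr_ge0.
Qed.

Lemma vnorm_le_sum (h : V) : vnorm h <= \sum_(j < n) cabs (h ord0 j).
Proof.
rewrite -[leRHS]ger0_norm; last by rewrite sumr_ge0// => i _; exact: cabs_ge0.
rewrite -sqrtr_sqr ler_wsqrtr//.
suff [] : 0 <= \sum_(j < n) cabs (h ord0 j) /\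
  \sum_(j < n) cabs (h ord0 j) ^+ 2 <= (\sum_(j < n) cabs (h ord0 j)) ^+ 2 by [].
elim/big_ind2: _ => [|a b c e [a0 ab] [c0 ce]|i _].
- by rewrite expr0n.
- split; first by rewrite addr_ge0.
  by rewrite sqrrD (le_trans (lerD ab ce))// lerD2r lerDl mulrn_wge0// mulr_ge0.
- by rewrite cabs_ge0.
Qed.

Lemma Copen_measurable U : Copen U -> measurable (U : set B).
Proof. by move=> oU; exact: sub_sigma_algebra. Qed.

Definition econt (g : V -> R) (z : V) := forall e : R, 0 < e ->
  exists2 delta : R, 0 < delta & forall y, vnorm (y - z) < delta -> `|g y - g z| < e.

Lemma Copen_gt Om (g : V -> R) t : Copen Om -> (forall z, Om z -> econt g z) ->
  Copen (Om `&` [set z | t < g z]).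
Proof.
move=> oOm cg z [Oz tz].
have [e1 e10 h1] := oOm z Oz.
have gtz : 0 < g z - t by rewrite subr_gt0.
have [e2 e20 h2] := cg z Oz _ gtz.
exists (Num.min e1 e2); first by rewrite lt_min e10.
move=> y; rewrite lt_min => /andP[y1 y2]; split; first exact: h1.
by have := h2 y y2; rewrite /= ltr_norml => /andP[+ _]; lra.
Qed.

(** Open half-lines generate the Borel sets of the line, so semicontinuity suffices; it is the form
    of regularity established for [Knorm]. *)
Lemma lsc_measurable Om (g : V -> R) : Copen Om ->
  (forall t, Copen (Om `&` [set z | t < g z])) ->
  measurable_fun (Om : set B) (g : B -> R).
Proof.
move=> oOm cg; apply: (measurability _ (RGenOInfty.measurableE R)).
move=> _ [_ [t ->] <-].
rewrite (_ : _ `&` _ = Om `&` [set z | t < g z]); first exact: Copen_measurable.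
by rewrite preimage_itvoy.
Qed.

Lemma econt_measurable Om (g : V -> R) : Copen Om ->
  (forall z, Om z -> econt g z) -> measurable_fun (Om : set B) (g : B -> R).
Proof. by move=> oOm cg; apply: lsc_measurable => // t; exact: Copen_gt. Qed.

Lemma holo_cont Om (f : V -> R[i]) z : holo_on Om f -> Om z ->
  forall e : R, 0 < e -> exists2 delta : R, 0 < delta &
    forall y, vnorm (y - z) < delta -> cabs (f y - f z) < e.
Proof.
move=> hf Oz e e0; have [a ha] := hf z Oz.
have [d d0 hd] := ha 1 ltr01.
(* Differentiability with error 1 gives |f y - f z| <= S |y - z| near [z]. *)
pose S := 1 + \sum_(j < n) cabs (a ord0 j).
have S0 : 0 < S.
  by rewrite ltr_pwDl// sumr_ge0// => j _; exact: cabs_ge0.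
exists (Num.min d (e / S)); first by rewrite lt_min d0 divr_gt0.
move=> y; rewrite lt_min => /andP[y1 y2].
have := hd _ y1; rewrite [z + _](_ : _ = y :> V); last by rewrite addrC subrK.
set L := \sum_(j < n) _; move=> h1.
have hL : cabs L <= (\sum_(j < n) cabs (a ord0 j)) * vnorm (y - z).
  rewrite (le_trans (ler_cabs_sum _ _))// mulr_suml ler_sum// => j _.
  by rewrite cabsM ler_wpM2l ?cabs_ge0// cabs_le_vnorm.
rewrite -[f y - f z](subrK L) (le_lt_trans (ler_cabsD _ _))//.
apply: (le_lt_trans (lerD h1 hL)); rewrite -mulrDl -/S mulrC.
by rewrite -ltr_pdivlMr.
Qed.

Lemma holo_econt_cabs Om (f : V -> R[i]) z : holo_on Om f -> Om z ->
  econt (fun w => cabs (f w)) z.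
Proof.
move=> hf Oz e e0; have [d d0 hd] := holo_cont hf Oz e0.
by exists d => // y /hd; apply: le_lt_trans; exact: ler_dist_cabs.
Qed.

Lemma holo_econt_Re Om (f : V -> R[i]) z : holo_on Om f -> Om z ->
  econt (fun w => complex.Re (f w)) z.
Proof.
move=> hf Oz e e0; have [d d0 hd] := holo_cont hf Oz e0.
exists d => // y /hd; apply: le_lt_trans.
by rewrite -ReN -ReD ler_Re_cabs.
Qed.

Lemma holo_econt_Im Om (f : V -> R[i]) z : holo_on Om f -> Om z ->
  econt (fun w => complex.Im (f w)) z.
Proof.
move=> hf Oz e e0; have [d d0 hd] := holo_cont hf Oz e0.
exists d => // y /hd; apply: le_lt_trans.
by rewrite -ImN -ImD ler_Im_cabs.
Qed.

Lemma holo_map_preimage_open Om (F : V -> V) U : Copen Om -> holo_map_on Om F ->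
  Copen U -> Copen (Om `&` F @^-1` U).
Proof.
move=> oOm hF oU z [Oz Uz].
have [e e0 he] := oU _ Uz.
have [d1 d10 h1] := oOm z Oz.
(* Dividing by [n.+1] covers n = 0 and keeps the sum of [n] coordinate errors strictly below [e]. *)
pose e' := e / n.+1%:R.
have e'0 : 0 < e' by rewrite divr_gt0.
have /choice[dl hdl] (j : 'I_n) : exists delta : R, 0 < delta /\
    forall y, vnorm (y - z) < delta -> cabs (F y ord0 j - F z ord0 j) < e'.
  by have [d d0 hd] := holo_cont (hF j) Oz e'0; exists d.
(* Starting the minimum at [d1] keeps the ball inside [Om]. *)
pose D := \big[Num.min/d1]_(j < n) dl j.
have D0 : 0 < D.
  apply: (big_ind (fun x => 0 < x)) => // [x y x0 y0|j _].
    by rewrite lt_min x0.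
  by have [] := hdl j.
exists D => // y yD; split.
  by apply: h1; apply: lt_le_trans yD _; exact: bigmin_le_id.
apply: he; apply: (le_lt_trans (vnorm_le_sum _)).
apply: (@le_lt_trans _ _ (\sum_(j < n) e')).
  apply: ler_sum => j _; rewrite !mxE ltW//; apply (hdl j).2.
  by apply: lt_le_trans yD _; exact: bigmin_le_cond.
rewrite sumr_const card_ord -mulr_natr /e' -mulrA gtr_pMr//.
by rewrite mulrC ltr_pdivrMr// mul1r ltr_nat.
Qed.

End EuclideanTopology.

Lemma measurable_funV_gt0 (d : measure_display) (T : measurableType d) (R : realType)
    (D : set T) (f : T -> R) : (forall x, D x -> 0 < f x) ->
  measurable_fun D f -> measurable_fun D (fun x => (f x)^-1).
Proof.
move=> f0 mf; apply: (@eq_measurable_fun _ _ _ _ _ (fun x => f x `^ (-1))).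
  by move=> x /set_mem Dx; rewrite powR_inv1// ltW// f0.
exact: (measurableT_comp (measurable_powR (-1)) mf).
Qed.

(** * Joint measurability of separately regular functions *)

Section JointMeasurability.
Variables (R : realType) (n : nat).
Local Notation V := (Cn R n).
Local Notation B := (CBorel R n).

(** A dense family in C^n whose index type is countable, so that [unpickle] enumerates it. *)
Definition rat_point (u : 'rV[rat * rat]_n) : V :=
  \row_j Complex (ratr (u ord0 j).1) (ratr (u ord0 j).2).

(** Polydiscs replace Euclidean balls because approximation by rational points is done coordinate by
    coordinate. *)
Definition box (x : V) (e : R) : set V :=
  [set z | forall j, cabs (z ord0 j - x ord0 j) < e].

Lemma box_open (x : V) (e : R) : Copen (box x e).
Proof.
move=> z zx.
pose D := \big[Num.min/1]_(j < n) (e - cabs (z ord0 j - x ord0 j)).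
exists D.
  apply: (big_ind (fun x => 0 < x)) => // [a b a0 b0|j _]; first by rewrite lt_min a0.
  by rewrite subr_gt0; exact: zx.
move=> y yD j.
rewrite (_ : _ - _ = (y - z) ord0 j + (z ord0 j - x ord0 j)).
  rewrite (le_lt_trans (ler_cabsD _ _))// -ltrBrDr.
  apply: (le_lt_trans (cabs_le_vnorm _ _)); apply: (lt_le_trans yD).
  exact: bigmin_le_cond.
by rewrite !mxE addrA subrK.
Qed.

Lemma rat_point_dense (z : V) (e : R) : 0 < e ->
  exists u, box (rat_point u) e z.
Proof.
move=> e0.
have rd (r : R) : exists q : rat, `|r - ratr q| < e / 2.
  have [|q] := @rat_in_itvoo R (r - e / 2) (r + e / 2); first lra.
  rewrite in_itv/= => /andP[q1 q2]; exists q; rewrite ltr_norml; lra.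
have /choice[u hu] (j : 'I_n) : exists q : rat * rat,
    cabs (z ord0 j - Complex (ratr q.1) (ratr q.2)) < e.
  have [q1 h1] := rd (complex.Re (z ord0 j)).
  have [q2 h2] := rd (complex.Im (z ord0 j)).
  exists (q1, q2); apply: (le_lt_trans (cabs_le_ReIm _)).
  by rewrite ReD ImD ReN ImN/=; lra.
by exists (\row_j u j) => j; rewrite !mxE.
Qed.

Lemma box_vnorm (x z : V) (e : R) : 0 < e -> box x (e / n.+1%:R) z ->
  vnorm (x - z) < e.
Proof.
move=> e0 h; apply: (le_lt_trans (vnorm_le_sum _)).
apply: (@le_lt_trans _ _ (\sum_(j < n) (e / n.+1%:R))).
  by apply: ler_sum => j _; rewrite !mxE -cabsN opprB ltW.
rewrite sumr_const card_ord -[_ *+ n]mulr_natr -mulrA gtr_pMr//.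
by rewrite mulrC ltr_pdivrMr// mul1r ltr_nat.
Qed.

(* [t < N z w] holds iff [N x w >= t + 1/(m+1)], for some [m], at all rational
   points [x] close to [z]: this turns the superlevel sets of [N] into
   countable combinations of measurable rectangles. *)
Lemma separately_continuous_measurable (Om : set V) (N : V -> V -> R) : Copen Om ->
  (forall z, Om z -> measurable_fun (Om : set B) (N z : B -> R)) ->
  (forall z w, Om z -> Om w -> econt (N^~ w) z) ->
  measurable_fun ((Om `*` Om) : set (B * B)) (fun x => N x.1 x.2).
Proof.
move=> oOm mN cN; have mOm := Copen_measurable oOm.
apply: (measurability _ (RGenOInfty.measurableE R)) => _ [_ [t ->] <-].
(* A rational point outside [Om], or an index that decodes to no point, imposes no condition. *)
pose A (m k i : nat) : set (B * B) := (Om `*` Om) `&`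
  [set x | match (unpickle i : option 'rV[rat * rat]_n) with
     | Some u => Om (rat_point u) -> box (rat_point u) k.+1%:R^-1 x.1 ->
                 t + m.+1%:R^-1 <= N (rat_point u) x.2
     | None => True end].
rewrite (_ : _ `&` _ = \bigcup_m \bigcup_k \bigcap_i A m k i).
  apply: bigcupT_measurable => m; apply: bigcupT_measurable => k.
  apply: bigcapT_measurable => i; rewrite /A.
  case: unpickle => [u|]; last first.
    by rewrite (_ : [set _ | True] = setT)// setIT; exact: measurableX.
  have [Ou|nOu] := pselect (Om (rat_point u)); last first.
    rewrite (_ : [set _ | _] = setT) ?setIT; first exact: measurableX.
    by apply/seteqP; split=> // x _ /= /nOu.
  (* Either [z] is far from the rational point or the test on [w] holds: a union of two
     rectangles. *)
  rewrite (_ : _ `&` _ =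
    ((Om `\` box (rat_point u) k.+1%:R^-1) `*` Om) `|`
    (Om `*` (Om `&` [set w | t + m.+1%:R^-1 <= N (rat_point u) w]))).
    apply: measurableU; apply: measurableX => //.
      by apply: measurableD => //; apply: Copen_measurable; exact: box_open.
    by rewrite -preimage_itvcy; apply: mN => //; exact: measurable_itv.
  apply/seteqP; split=> [[z w]/= [[Oz Ow] h]|[z w]/= [[[Oz nz] Ow]|[Oz [Ow h]]]].
  - by have [b|nb] := pselect (box (rat_point u) k.+1%:R^-1 z);
      [right; split=> //; split => //; exact: h|left].
  - by split.
  - by split.
apply/seteqP; split=> [[z w]/= [[Oz Ow]]|[z w]/= [m _ [k _ h]]].
  rewrite in_itv/= andbT => /ltr_add_invr[m hm].
  have e0 : 0 < N z w - (t + m.+1%:R^-1) by rewrite subr_gt0.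
  have [d d0 hd] := cN z w Oz Ow _ e0.
  have dn0 : 0 < d / n.+1%:R by rewrite divr_gt0.
  have [k] := ltr_add_invr dn0; rewrite add0r => hk.
  exists m => //; exists k => // i _; split => //=.
  case: unpickle => // u Ou bu.
  have /hd : vnorm (rat_point u - z) < d.
    by apply: box_vnorm => // j; exact: lt_trans (bu j) hk.
  by rewrite ltr_norml opprB ltrD2r => /andP[/ltW].
have [[Oz Ow] _] : A m k 0%N (z, w) by exact: h.
split => //; rewrite in_itv/= andbT.
have m0 : 0 < m.+1%:R^-1 :> R by rewrite invr_gt0.
have [d d0 hd] := cN z w Oz Ow _ m0.
have [e e0 he] := oOm z Oz.
(* The three radii make the rational point subject to the test, move [N] by less than 1/(m+1), and
   keep the point in [Om]. *)
pose r := Num.min (k.+1%:R^-1) (Num.min (d / n.+1%:R) (e / n.+1%:R)) : R.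
have r0 : 0 < r by rewrite !lt_min invr_gt0 ltr0Sn !divr_gt0.
have [u hu] := rat_point_dense z r0.
have /hd : vnorm (rat_point u - z) < d.
  by apply: box_vnorm => // j; apply: lt_le_trans (hu j) _; rewrite !ge_min lexx !orbT.
have Ou : Om (rat_point u).
  apply: he; apply: box_vnorm => // j; apply: lt_le_trans (hu j) _.
  by rewrite !ge_min lexx !orbT.
have [_ /=] := h (pickle u) Logic.I; rewrite pickleK => /(_ Ou) H.
have /H : box (rat_point u) k.+1%:R^-1 z.
  by move=> j; apply: lt_le_trans (hu j) _; rewrite !ge_min lexx.
by rewrite ltr_norml => h1 /andP[_]; rewrite ltrBlDr addrC => /(le_lt_trans h1); rewrite ltrD2r.
Qed.

End JointMeasurability.

(** * The pre-Hilbert structure of B(Om): integrability, sesquilinearity, Cauchy-Schwarz *)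

Section L2space.
Variables (R : realType) (n : nat) (sigma : {measure set (CBorel R n) -> \bar R}).
Variable Om : set (Cn R n).
Hypothesis oOm : Copen Om.
Local Notation C := R[i].
Local Notation V := (Cn R n).
Local Notation B := (CBorel R n).
Local Notation Bs := (Bspace sigma Om).
Local Notation ip := (inner sigma Om).

Let mOm : measurable (Om : set B). Proof. exact: Copen_measurable. Qed.

Definition cintegrable (h : V -> C) :=
  sigma.-integrable (Om : set B) (fun x => (complex.Re (h x))%:E) /\
  sigma.-integrable (Om : set B) (fun x => (complex.Im (h x))%:E).

(** Linearity is packed into [a * h1 + h2] throughout, the shape in which linearity of [T] is
    given. *)
Lemma cintegralDZ (a : C) (h1 h2 : V -> C) : cintegrable h1 -> cintegrable h2 ->
  cintegral sigma Om (fun x => a * h1 x + h2 x) =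
  a * cintegral sigma Om h1 + cintegral sigma Om h2.
Proof.
move=> [r1 i1] [r2 i2].
have iZ (c : R) (g : V -> R) : sigma.-integrable (Om : set B) (fun x => (g x)%:E) ->
    sigma.-integrable (Om : set B) (fun x => (c * g x)%:E).
  by move=> ig; under eq_fun do rewrite EFinM; exact: integrableZl.
have iD (g1 g2 : V -> R) : sigma.-integrable (Om : set B) (fun x => (g1 x)%:E) ->
    sigma.-integrable (Om : set B) (fun x => (g2 x)%:E) ->
    sigma.-integrable (Om : set B) (fun x => (g1 x + g2 x)%:E).
  by move=> ig1 ig2; under eq_fun do rewrite EFinD; exact: integrableD.
apply: complexP.
  rewrite ReD ReM/=.
  under eq_Rintegral do rewrite ReD ReM -mulNr.
  rewrite RintegralD//; last by apply: iD; exact: iZ.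
  by rewrite RintegralD ?RintegralZl ?mulNr//; exact: iZ.
rewrite ImD ImM/=.
under eq_Rintegral do rewrite ImD ImM.
rewrite RintegralD//; last by apply: iD; exact: iZ.
by rewrite RintegralD ?RintegralZl//; exact: iZ.
Qed.

Lemma Bspace_measurable_Re f : Bs f ->
  measurable_fun (Om : set B) (fun x : B => complex.Re (f x)).
Proof. by case=> hf _; apply: econt_measurable => // z; exact: holo_econt_Re. Qed.

Lemma Bspace_measurable_Im f : Bs f ->
  measurable_fun (Om : set B) (fun x : B => complex.Im (f x)).
Proof. by case=> hf _; apply: econt_measurable => // z; exact: holo_econt_Im. Qed.

Lemma Bspace_measurable_cabs f : Bs f ->
  measurable_fun (Om : set B) (fun x : B => cabs (f x)).
Proof. by case=> hf _; apply: econt_measurable => // z; exact: holo_econt_cabs. Qed.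

Lemma Bspace_integrable_sqr f : Bs f ->
  sigma.-integrable (Om : set B) (fun x => (cabs (f x) ^+ 2)%:E).
Proof.
move=> Bf; have [_ [_ fi]] := Bf; apply/integrableP; split.
  by apply/measurable_EFinP; apply: measurable_funX; exact: Bspace_measurable_cabs.
by under eq_integral do rewrite gee0_abs ?lee_fin ?sqr_ge0//.
Qed.

Lemma integrable_mul_cabs f g : Bs f -> Bs g ->
  sigma.-integrable (Om : set B) (fun x => (cabs (f x) * cabs (g x))%:E).
Proof.
move=> Bf Bg.
apply: (@le_integrable _ _ _ _ _ mOm _
   (fun x => (cabs (f x) ^+ 2)%:E + (cabs (g x) ^+ 2)%:E)%E).
- apply/measurable_EFinP; apply: measurable_funM; exact: Bspace_measurable_cabs.
- move=> x _; rewrite -EFinD !gee0_abs ?lee_fin; last 2 first.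
    by rewrite addr_ge0// sqr_ge0.
    by rewrite mulr_ge0// cabs_ge0.
  have := sqr_ge0 (cabs (f x) - cabs (g x)).
  have := sqr_ge0 (cabs (f x) + cabs (g x)).
  by nra.
- by apply: integrableD => //; exact: Bspace_integrable_sqr.
Qed.

Lemma cintegrable_inner f g : Bs f -> Bs g -> cintegrable (fun x => f x * (g x)^*).
Proof.
move=> Bf Bg; split.
  apply: (@le_integrable _ _ _ _ _ mOm _ (fun x => (cabs (f x) * cabs (g x))%:E)).
  - apply/measurable_EFinP; rewrite [X in measurable_fun _ X](_ : _ =
      (fun x => complex.Re (f x) * complex.Re (g x)) \+
      (fun x => complex.Im (f x) * complex.Im (g x))).
      by apply: measurable_funD; apply: measurable_funM;
        [exact: Bspace_measurable_Re|exact: Bspace_measurable_Re|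
         exact: Bspace_measurable_Im|exact: Bspace_measurable_Im].
    by apply/funext => x /=; rewrite ReM conjRe conjIm mulrN opprK.
  - move=> x _; rewrite /= lee_fin [leRHS]ger0_norm ?mulr_ge0 ?cabs_ge0//.
    by rewrite -(cabs_conj (g x)) -cabsM ler_Re_cabs.
  - exact: integrable_mul_cabs.
apply: (@le_integrable _ _ _ _ _ mOm _ (fun x => (cabs (f x) * cabs (g x))%:E)).
- apply/measurable_EFinP; rewrite [X in measurable_fun _ X](_ : _ =
    (fun x => complex.Im (f x) * complex.Re (g x)) \-
    (fun x => complex.Re (f x) * complex.Im (g x))).
    by apply: measurable_funB; apply: measurable_funM;
      [exact: Bspace_measurable_Im|exact: Bspace_measurable_Re|
       exact: Bspace_measurable_Re|exact: Bspace_measurable_Im].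
  by apply/funext => x /=; rewrite ImM conjRe conjIm mulrN addrC.
- move=> x _; rewrite /= lee_fin [leRHS]ger0_norm ?mulr_ge0 ?cabs_ge0//.
  by rewrite -(cabs_conj (g x)) -cabsM ler_Im_cabs.
- exact: integrable_mul_cabs.
Qed.

Lemma holo_onDZ (a : C) f g : holo_on Om f -> holo_on Om g ->
  holo_on Om (fun w => a * f w + g w).
Proof.
move=> hf hg z Oz; have [A hA] := hf z Oz; have [A' hA'] := hg z Oz.
exists (a *: A + A') => e e0.
have c0 : 0 < cabs a + 1 by rewrite ltr_wpDl// cabs_ge0.
have e1 : 0 < e / (cabs a + 1) by rewrite divr_gt0.
have [d1 d10 h1] := hA _ e1; have [d2 d20 h2] := hA' _ e1.
exists (Num.min d1 d2); first by rewrite lt_min d10.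
move=> h; rewrite lt_min => /andP[/h1 k1 /h2 k2].
rewrite (_ : _ - _ = a * (f (z + h) - f z - \sum_(j < n) A ord0 j * h ord0 j) +
  (g (z + h) - g z - \sum_(j < n) A' ord0 j * h ord0 j)); last first.
  rewrite (_ : \sum_(j < n) (a *: A + A') ord0 j * h ord0 j =
    a * \sum_(j < n) A ord0 j * h ord0 j + \sum_(j < n) A' ord0 j * h ord0 j).
    by ring.
  by rewrite mulr_sumr -big_split/=; apply: eq_bigr => j _; rewrite !mxE mulrDl mulrA.
rewrite (le_trans (ler_cabsD _ _))// cabsM.
apply: (le_trans (lerD (ler_wpM2l (cabs_ge0 a) k1) k2)).
by rewrite le_eqVlt; apply/orP; left; apply/eqP; field; rewrite gt_eqF.
Qed.

Lemma BspaceDZ (a : C) f g : Bs f -> Bs g -> Bs (fun w => a * f w + g w).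
Proof.
move=> Bf Bg; have [hf [f0 fi]] := Bf; have [hg [g0 gi]] := Bg.
split; first exact: holo_onDZ.
split; first by move=> w nw; rewrite f0// g0// mulr0 addr0.
have m1 (h : V -> C) : Bs h -> measurable_fun (Om : set B) (fun x => (cabs (h x) ^+ 2)%:E).
  by move=> Bh; apply/measurable_EFinP; apply: measurable_funX; exact: Bspace_measurable_cabs.
apply: (@le_lt_trans _ _ (\int[sigma]_(x in (Om : set B))
   ((2 * cabs a ^+ 2)%:E * (cabs (f x) ^+ 2)%:E + 2%:E * (cabs (g x) ^+ 2)%:E))%E).
  apply: ge0_le_integral => //.
  - by move=> x _; rewrite lee_fin sqr_ge0.
  - by apply/measurable_EFinP; apply: measurable_funX; apply: econt_measurable => // z;
      apply: holo_econt_cabs; exact: holo_onDZ.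
  - by apply: emeasurable_funD; apply: measurable_funeM; exact: m1.
  - move=> x _; rewrite -!EFinM -EFinD lee_fin.
    have := ler_cabsD (a * f x) (g x); rewrite cabsM.
    have := cabs_ge0 (a * f x + g x).
    set X := cabs a * _; set Y := cabs (g x); set Z := cabs _.
    move=> Z0 ZXY; apply: (@le_trans _ _ ((X + Y) ^+ 2)).
      by rewrite lerXn2r ?nnegrE// (le_trans Z0).
    have := sqr_ge0 (X - Y); rewrite -mulrA -exprMn -/X; nra.
rewrite ge0_integralD//; last 4 first.
- by move=> x _; rewrite -EFinM lee_fin !(sqr_ge0, mulr_ge0, cabs_ge0).
- by apply: measurable_funeM; exact: m1.
- by move=> x _; rewrite -EFinM lee_fin !(sqr_ge0, mulr_ge0, cabs_ge0).
- by apply: measurable_funeM; exact: m1.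
have c0 : 0 <= 2 * cabs a ^+ 2 by rewrite mulr_ge0// sqr_ge0.
have p0 (h : V -> C) (x : V) : Om x -> (0 <= (cabs (h x) ^+ 2)%:E)%E.
  by move=> _; rewrite lee_fin sqr_ge0.
rewrite (ge0_integralZl_EFin _ mOm (p0 f) (m1 f Bf) c0).
rewrite (ge0_integralZl_EFin _ mOm (p0 g) (m1 g Bg) (ler0n _ 2)).
by apply: lte_add_pinfty; apply: lte_mul_pinfty.
Qed.

Lemma Bspace0 : Bs (fun=> 0).
Proof.
split.
  move=> z _; exists 0 => e e0; exists 1 => // h _.
  rewrite big1 ?subr0 ?cabs0 ?mulr_ge0 ?vnorm_ge0 ?ltW// => j _.
  by rewrite mxE mul0r.
split => //; under eq_integral do rewrite cabs0 expr0n/=.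
by rewrite integral0.
Qed.

Lemma BspaceZ (a : C) f : Bs f -> Bs (fun w => a * f w).
Proof.
move=> Bf; rewrite (_ : (fun _ => _) = (fun w => a * f w + 0)).
  exact: (BspaceDZ a Bf Bspace0).
by apply/funext => w; rewrite addr0.
Qed.

Lemma innerDZ (a : C) f g h : Bs f -> Bs g -> Bs h ->
  ip (fun w => a * f w + g w) h = a * ip f h + ip g h.
Proof.
move=> Bf Bg Bh; rewrite /inner -cintegralDZ; [|exact: cintegrable_inner..].
by congr cintegral; apply/funext => x; rewrite mulrDl mulrA.
Qed.

Lemma inner_conj f g : Bs f -> Bs g -> ip g f = (ip f g)^*.
Proof.
move=> Bf Bg; have [_ ii] := cintegrable_inner Bf Bg.
apply: complexP; rewrite /= ?conjRe ?conjIm/=.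
  by apply: eq_Rintegral => x _; rewrite !ReM !conjRe !conjIm; ring.
rewrite -mulN1r -RintegralZl//.
by apply: eq_Rintegral => x _; rewrite !ImM !conjRe !conjIm; ring.
Qed.

Lemma inner0l g : ip (fun=> 0) g = 0.
Proof.
rewrite /inner /cintegral; apply: complexP => /=;
  rewrite (@eq_Rintegral _ _ _ sigma Om (fun=> 0)) ?Rintegral_cst ?mul0r// => x _.
  by rewrite mul0r.
by rewrite mul0r.
Qed.

Lemma innerZl (a : C) f h : Bs f -> Bs h -> ip (fun w => a * f w) h = a * ip f h.
Proof.
move=> Bf Bh; rewrite (_ : (fun w => a * f w) = (fun w => a * f w + 0)).
  by rewrite (innerDZ a Bf Bspace0 Bh) inner0l addr0.
by apply/funext => w; rewrite addr0.
Qed.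

Lemma innerDZr (a : C) f g h : Bs f -> Bs g -> Bs h ->
  ip h (fun w => a * f w + g w) = a^* * ip h f + ip h g.
Proof.
move=> Bf Bg Bh; rewrite (inner_conj (BspaceDZ a Bf Bg) Bh).
by rewrite innerDZ// rmorphD rmorphM/= -!inner_conj.
Qed.

Lemma innerZr (a : C) f h : Bs f -> Bs h -> ip h (fun w => a * f w) = a^* * ip h f.
Proof.
move=> Bf Bh; rewrite (inner_conj (BspaceZ a Bf) Bh).
by rewrite innerZl// rmorphM/= -!inner_conj.
Qed.

(** The Hilbert space identities are polynomial in the squared norm, so square roots appear only
    where [L2norm] itself is met. *)
Definition sqnorm (f : V -> C) : R :=
  fine (\int[sigma]_(x in (Om : set B)) (cabs (f x) ^+ 2)%:E)%E.

Lemma sqnorm_ge0 f : 0 <= sqnorm f.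
Proof. by rewrite fine_ge0// integral_ge0// => x _; rewrite lee_fin sqr_ge0. Qed.

Lemma sqr_L2norm f : L2norm sigma Om f ^+ 2 = sqnorm f.
Proof. by rewrite sqr_sqrtr// sqnorm_ge0. Qed.

Lemma L2norm_ge0 f : 0 <= L2norm sigma Om f.
Proof. exact: sqrtr_ge0. Qed.

Lemma innerff f : ip f f = Complex (sqnorm f) 0.
Proof.
apply: complexP => /=.
  by congr fine; apply: eq_integral => x _; rewrite ReM conjRe conjIm mulrN opprK sqr_cabs !expr2.
rewrite (@eq_Rintegral _ _ _ sigma Om (fun=> 0)) ?Rintegral_cst ?mul0r// => x _.
by rewrite ImM conjRe conjIm; ring.
Qed.

Lemma sqnormDZ (a : C) f g : Bs f -> Bs g ->
  sqnorm (fun w => a * f w + g w) =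
  cabs a ^+ 2 * sqnorm f + sqnorm g + 2 * complex.Re (a * ip f g).
Proof.
move=> Bf Bg.
have := innerff (fun w => a * f w + g w); have Bh := BspaceDZ a Bf Bg.
rewrite innerDZ// !innerDZr// (inner_conj Bf Bg) !innerff.
move=> /(congr1 (@complex.Re R)) /= <-.
case: (ip f g) => x y; case: a {Bh} => b c.
by rewrite sqr_cabs !(ReD, ReM, ImD, ImM, conjRe, conjIm)/=; ring.
Qed.

Lemma sqnormZ (a : C) f : Bs f -> sqnorm (fun w => a * f w) = cabs a ^+ 2 * sqnorm f.
Proof.
move=> Bf.
have := innerff (fun w => a * f w); rewrite innerZl//; last exact: BspaceZ.
rewrite innerZr// innerff => /(congr1 (@complex.Re R)) /= <-.
by case: a => b c; rewrite sqr_cabs !(ReM, ImM, conjRe, conjIm)/=; ring.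
Qed.

(** The squared norm of g - s <f,g>^* f is non-negative for all real s, and s = 1 / ||f||^2
    minimises it. *)
Lemma cauchy_schwarz_sqr f g : Bs f -> Bs g ->
  cabs (ip f g) ^+ 2 <= sqnorm f * sqnorm g.
Proof.
move=> Bf Bg; set P := _ ^+ 2; set X := sqnorm f; set Y := sqnorm g.
have X0 : 0 <= X by exact: sqnorm_ge0.
have Y0 : 0 <= Y by exact: sqnorm_ge0.
have P0 : 0 <= P by exact: sqr_ge0.
have H (s : R) : 0 <= P * s ^+ 2 * X + Y - 2 * s * P.
  have := sqnorm_ge0 (fun w => (Complex (- s) 0 * (ip f g)^*) * f w + g w).
  rewrite sqnormDZ// cabsM cabs_conj exprMn -/P -/X -/Y.
  rewrite (_ : cabs (Complex _ _) ^+ 2 = s ^+ 2); last by rewrite sqr_cabs/=; ring.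
  have -> : complex.Re (Complex (- s) 0 * (ip f g)^* * ip f g) = - s * P.
    by rewrite /P sqr_cabs; case: (ip f g) => x y;
      rewrite !(ReM, ImM, conjRe, conjIm)/=; ring.
  by move=> h; rewrite (le_trans h)// le_eqVlt; apply/orP; left; apply/eqP; ring.
have [->|Pn] := eqVneq P 0; first by rewrite mulr_ge0.
have Pp : 0 < P by rewrite lt_def Pn.
have [X00|Xn] := eqVneq X 0.
  (* When [X] vanishes the form is affine in [s], and this [s] gives it the negative value -Y -
     2. *)
  have := H ((Y + 1) / P); rewrite X00 mulr0 add0r -mulrA divfK//; lra.
have Xp : 0 < X by rewrite lt_def Xn.
have := H X^-1; rewrite (_ : _ + _ = Y - P / X).
  by rewrite subr_ge0 ler_pdivrMr// mulrC.
by field.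
Qed.

Lemma cauchy_schwarz f g : Bs f -> Bs g ->
  cabs (ip f g) <= L2norm sigma Om f * L2norm sigma Om g.
Proof.
move=> Bf Bg; rewrite -(@ler_pXn2r _ 2)// ?nnegrE ?mulr_ge0 ?cabs_ge0 ?L2norm_ge0//.
by rewrite exprMn !sqr_L2norm cauchy_schwarz_sqr.
Qed.

(** Multiplying by the unimodular number [u] makes the integral equal to its modulus, and the real
    part of the rotated integrand is at most |f| |g|. Schur's test needs this form, with the modulus
    inside the integral. *)
Lemma cabs_inner_le_integral f g : Bs f -> Bs g ->
  ((cabs (ip f g))%:E <= \int[sigma]_(x in (Om : set B)) (cabs (f x) * cabs (g x))%:E)%E.
Proof.
move=> Bf Bg; set c := ip f g.
have [ir ii] := cintegrable_inner Bf Bg.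
have [->|cn] := eqVneq c 0.
  rewrite cabs0 integral_ge0// => x _.
  by rewrite lee_fin mulr_ge0// cabs_ge0.
have cc : cabs c != 0 by apply: contraNneq cn => /cabs_eq0 ->.
pose u := c^* / Complex (cabs c) 0.
have u1 : cabs u = 1.
  by rewrite cabsM cabsV cabs_conj cabs_real ?cabs_ge0// divff.
have uc : u * c = Complex (cabs c) 0.
  rewrite /u mulrAC; apply: (canLR (mulfK _)).
    by apply: contraNneq cc => /(congr1 (@complex.Re R)) /= ->.
  have := sqr_cabs c; case: (c) => x y h.
  apply: complexP; rewrite !(ReM, ImM, conjRe, conjIm)/=; last by ring.
  by rewrite mulr0 subr0 -!expr2 h/=; ring.
have e : cabs c = complex.Re (cintegral sigma Om (fun x => u * (f x * (g x)^*) + 0)).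
  rewrite cintegralDZ//; last first.
    by split; exact: integrable0.
  rewrite -/(ip f g) -/c uc ReD/= (@eq_Rintegral _ _ _ sigma Om (fun=> 0))// Rintegral_cst//.
  by rewrite mul0r addr0.
have iu : cintegrable (fun x => u * (f x * (g x)^*) + 0).
  rewrite (_ : (fun _ => _) = fun x => (u * f x) * (g x)^*).
    by apply: cintegrable_inner => //; exact: BspaceZ.
  by apply/funext => x; rewrite addr0 mulrA.
have [iur _] := iu.
rewrite e (_ : complex.Re _ = Rintegral sigma Om
  (fun x => complex.Re (u * (f x * (g x)^*) + 0)))// /Rintegral fineK;
  last exact: integrable_fin_num.
apply: le_integral => //; first exact: integrable_mul_cabs.
move=> x _; rewrite lee_fin addr0 (le_trans (ler_norm _))//.
by rewrite (le_trans (ler_Re_cabs _))// cabsM u1 mul1r cabsM cabs_conj.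
Qed.

End L2space.

(** * Reproducing kernels: point evaluations, density of the span, extension by density *)

Section KernelSpan.
Variables (R : realType) (n : nat) (sigma : {measure set (CBorel R n) -> \bar R}).
Variables (Om : set (Cn R n)) (K : Cn R n -> Cn R n -> R[i]).
Hypothesis oOm : Copen Om.
Hypothesis finsig : (sigma setT < +oo)%E.
Hypothesis RK : reproducing_kernel sigma Om K.
Hypothesis Bc : Bcomplete sigma Om.
Local Notation C := R[i].
Local Notation V := (Cn R n).
Local Notation B := (CBorel R n).
Local Notation Bs := (Bspace sigma Om).
Local Notation ip := (inner sigma Om).
Local Notation KN := (Knorm sigma Om K).
Local Notation k_ := (nkernel sigma Om K).
Local Notation sq := (sqnorm sigma Om).
Local Notation ks := (kspan sigma Om K).

Lemma Bspace_K z : Om z -> Bs (K z). Proof. by case: RK => h _; exact: h. Qed.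

Lemma reproducing f z : Bs f -> Om z -> f z = ip f (K z).
Proof. by case: RK => _ h Bf; exact: h. Qed.

Lemma Bspace_k z : Om z -> Bs (k_ z).
Proof.
move=> Oz; rewrite /nkernel (_ : (fun _ => _) = fun w => (Complex (KN z) 0)^-1 * K z w).
  by apply: BspaceZ => //; exact: Bspace_K.
by apply/funext => w; rewrite mulrC.
Qed.

(** Finiteness of sigma puts the constant 1 in B(Om); since 1 = <1, K_z> at each z, no K_z can
    vanish. *)
Lemma Bspace_one : Bs (fun w => (w \in Om)%:R).
Proof.
split.
  move=> z Oz; have [e e0 he] := oOm Oz.
  exists 0 => e' e'0; exists e => // h hh.
  have Ozh : Om (z + h) by apply: he; rewrite [X in vnorm X](_ : _ = h)// addrC addKr.
  rewrite !mem_set// subrr big1 ?subr0 ?cabs0 ?mulr_ge0 ?vnorm_ge0 ?ltW// => j _.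
  by rewrite mxE mul0r.
split; first by move=> w nw; rewrite memNset.
rewrite (eq_integral (cst 1%:E)) => [|x xO].
  rewrite integral_cst ?mul1e; last exact: Copen_measurable.
  apply: le_lt_trans finsig; apply: le_measure => //; rewrite inE//.
  exact: Copen_measurable.
by rewrite xO cabs1 expr1n.
Qed.

Lemma Knorm_gt0 z : Om z -> 0 < KN z.
Proof.
move=> Oz; rewrite lt_def L2norm_ge0 andbT; apply/negP => /eqP h.
have := cauchy_schwarz oOm Bspace_one (Bspace_K Oz).
rewrite -(reproducing Bspace_one Oz) mem_set// -/(KN z) h mulr0.
by rewrite cabs1 ler10.
Qed.

Lemma Knorm_C_neq0 z : Om z -> Complex (KN z) 0 != 0.
Proof.
move=> Oz; apply/negP => /eqP /(congr1 (@complex.Re R)) /= h.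
by have := Knorm_gt0 Oz; rewrite h ltxx.
Qed.

Lemma KE z : Om z -> K z = fun w => Complex (KN z) 0 * k_ z w.
Proof.
by move=> Oz; apply/funext => w; rewrite /nkernel mulrC divfK// Knorm_C_neq0.
Qed.

Lemma sq_K z : sq (K z) = KN z ^+ 2. Proof. by rewrite sqr_L2norm. Qed.

Lemma cabs_eval_le f z : Bs f -> Om z -> cabs (f z) <= L2norm sigma Om f * KN z.
Proof.
move=> Bf Oz; rewrite (reproducing Bf Oz).
exact: (cauchy_schwarz oOm Bf (Bspace_K Oz)).
Qed.

Lemma K_diag z : Om z -> K z z = Complex (KN z ^+ 2) 0.
Proof. by move=> Oz; rewrite (reproducing (Bspace_K Oz) Oz) (innerff _ oOm) sq_K. Qed.

Lemma kspan0 : ks (fun=> 0).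
Proof. by exists [::]; split => //; apply/funext => w; rewrite big_nil. Qed.

Lemma kspan_k z : Om z -> ks (k_ z).
Proof.
move=> Oz; exists [:: (1, z)]; split; first by move=> x; rewrite inE => /eqP ->.
by apply/funext => w; rewrite big_seq1 mul1r.
Qed.

Lemma kspanDZ (a : C) f g : ks f -> ks g -> ks (fun w => a * f w + g w).
Proof.
move=> [s [hs ->]] [t [ht ->]].
exists ([seq (a * x.1, x.2) | x <- s] ++ t); split.
  move=> x; rewrite mem_cat => /orP[/mapP[y ys ->]|]; [exact: (hs y)|exact: ht].
apply/funext => w; rewrite big_cat big_map mulr_sumr; congr (_ + _).
by apply: eq_bigr => x _; rewrite mulrA.
Qed.

Lemma kspanZ (a : C) f : ks f -> ks (fun w => a * f w).
Proof.
move=> kf; rewrite (_ : (fun w => _) = fun w => a * f w + 0).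
  exact: (kspanDZ a kf kspan0).
by apply/funext => w; rewrite addr0.
Qed.

Lemma kspan_K z : Om z -> ks (K z).
Proof. by move=> Oz; rewrite (KE Oz); apply: kspanZ; exact: kspan_k. Qed.

(** The step keeps [ks f] because the operators are linear only on the span. *)
Lemma kspan_ind (P : (V -> C) -> Prop) : P (fun=> 0) ->
  (forall a z f, Om z -> ks f -> P f -> P (fun w => a * k_ z w + f w)) ->
  forall f, ks f -> P f.
Proof.
move=> P0 PS f [s [hs ->]]; elim: s hs => [|[a z] s IH] hs.
  rewrite (_ : (fun _ => _) = fun=> 0)//.
  by apply/funext => w; rewrite big_nil.
have Os x : x \in s -> Om x.2 by move=> xs; apply: hs; rewrite inE xs orbT.
rewrite (_ : (fun _ => _) = fun w => a * k_ z w + \sum_(x <- s) x.1 * k_ x.2 w).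
  apply: PS; [exact: (hs (a, z) (mem_head _ _)) | by exists s | exact: IH].
by apply/funext => w; rewrite big_cons.
Qed.

Lemma kspan_Bspace f : ks f -> Bs f.
Proof.
apply: kspan_ind; first exact: Bspace0.
by move=> a z g Oz _ Bg; apply: BspaceDZ => //; exact: Bspace_k.
Qed.

Lemma parallelogram f g : Bs f -> Bs g ->
  sq (fun w => 1 * f w + g w) + sq (fun w => -1 * f w + g w) = 2 * sq f + 2 * sq g.
Proof.
move=> Bf Bg; rewrite !sqnormDZ// cabsN cabs1 mulN1r mul1r ReN.
by ring.
Qed.

Lemma sqnormD_le f g : Bs f -> Bs g ->
  sq (fun w => 1 * f w + g w) <= 2 * sq f + 2 * sq g.
Proof.
move=> Bf Bg; rewrite -parallelogram// lerDl; exact: sqnorm_ge0.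
Qed.

Lemma L2norm_sub_sq f g : L2norm sigma Om (f \- g) ^+ 2 = sq (fun w => -1 * g w + f w).
Proof.
by rewrite sqr_L2norm; congr sqnorm; apply/funext => w; rewrite mulN1r addrC.
Qed.

(** Completeness restated with squared norms and with differences in the shape to which the
    linearity lemmas apply. *)
Lemma complete_sq (u : nat -> V -> C) : (forall k, Bs (u k)) ->
  (forall e : R, 0 < e -> exists N, forall k l, (N <= k)%N -> (N <= l)%N ->
     sq (fun w => -1 * u l w + u k w) < e) ->
  exists2 f, Bs f & forall e : R, 0 < e -> exists N, forall k, (N <= k)%N ->
     sq (fun w => -1 * f w + u k w) < e.
Proof.
move=> Bu cu; have [e e0|f Bf hf] := Bc Bu.
  have [|N hN] := cu (e ^+ 2); first by rewrite exprn_gt0.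
  exists N => k l Nk Nl; rewrite -(@ltr_pXn2r _ 2)// ?nnegrE ?L2norm_ge0 ?ltW//.
  by rewrite L2norm_sub_sq hN.
exists f => // e e0; have [|N hN] := hf (Num.sqrt e); first by rewrite sqrtr_gt0.
exists N => k /hN; rewrite -(@ltr_pXn2r _ 2)// ?nnegrE ?L2norm_ge0 ?sqrtr_ge0//.
by rewrite L2norm_sub_sq sqr_sqrtr// ltW.
Qed.

Lemma cabs_sqrD_le (x y : C) : cabs (x + y) ^+ 2 <= 2 * cabs x ^+ 2 + 2 * cabs y ^+ 2.
Proof.
have := ler_cabsD x y; have := cabs_ge0 (x + y).
set X := cabs x; set Y := cabs y; set Z := cabs _ => Z0 ZXY.
apply: (@le_trans _ _ ((X + Y) ^+ 2)).
  by rewrite lerXn2r ?nnegrE// (le_trans Z0).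
have := sqr_ge0 (X - Y); nra.
Qed.

Lemma cabs_sqr_small_eq0 (x : C) : (forall e : R, 0 < e -> cabs x ^+ 2 <= e) -> x = 0.
Proof.
move=> h; apply: cabs_eq0; apply/eqP; rewrite -sqrf_eq0.
by rewrite eq_le sqr_ge0 andbT; apply/ler_addgt0Pl => e e0; rewrite addr0; exact: h.
Qed.

(* A minimising sequence for the distance to the span is Cauchy by the
   parallelogram law, and the minimality makes its limit agree with [f] when
   tested against every [K z], i.e. pointwise. *)
Lemma kspan_dense f : Bs f -> exists g : nat -> V -> C, (forall k, ks (g k)) /\
  forall e : R, 0 < e -> exists N, forall k, (N <= k)%N ->
    sq (fun w => -1 * f w + g k w) < e.
Proof.
move=> Bf.
pose D g := sq (fun w => -1 * g w + f w).
pose E := [set D g | g in ks].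
have E0 : E !=set0 by exists (D (fun=> 0)); exists (fun=> 0) => //; exact: kspan0.
have lbE : lbound E 0 by move=> _ [g _ <-]; exact: sqnorm_ge0.
have hE : has_inf E by split => //; exists 0.
pose m := inf E.
have mle g : ks g -> m <= D g by move=> kg; apply: ge_inf; [exists 0|exists g].
have /choice[g hg] (k : nat) : exists g, ks g /\ D g < m + k.+1%:R^-1.
  have k0 : 0 < k.+1%:R^-1 :> R by rewrite invr_gt0.
  by have [_ [g kg <-] lt] := inf_adherent k0 hE; exists g.
have kg k : ks (g k) by case: (hg k).
have Bg k : Bs (g k) by exact: kspan_Bspace.
have Be k : Bs (fun w => -1 * g k w + f w) by exact: BspaceDZ.
have invS_small (e : R) : 0 < e -> exists N, forall k, (N <= k)%N -> k.+1%:R^-1 < e.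
  move=> e0; have [N] := ltr_add_invr e0; rewrite add0r => hN.
  exists N => k Nk; apply: le_lt_trans hN.
  by rewrite lef_pV2 ?posrE// ler_nat.
have cg (e : R) : 0 < e -> exists N, forall k l, (N <= k)%N -> (N <= l)%N ->
     sq (fun w => -1 * g l w + g k w) < e.
  move=> e0; have e40 : 0 < e / 4 by rewrite divr_gt0.
  have [N hN] := invS_small _ e40.
  exists N => k l /hN Nk /hN Nl.
  have := parallelogram (Be k) (Be l).
  have -> : (fun w => -1 * (-1 * g k w + f w) + (-1 * g l w + f w)) =
            (fun w => -1 * g l w + g k w) by apply/funext => w; ring.
  (* The sum is twice the error of the midpoint, which lies in the span, so its squared norm is at
     least 4m; what remains for the difference is 2/(k+1) + 2/(l+1). *)
  have -> : (fun w => 1 * (-1 * g k w + f w) + (-1 * g l w + f w)) =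
     fun w => 2 * (-1 * (2^-1 * g k w + 2^-1 * g l w) + f w).
    by apply/funext => w; field.
  have km : ks (fun w => 2^-1 * g k w + 2^-1 * g l w).
    by apply: kspanDZ => //; exact: kspanZ.
  rewrite sqnormZ//; last by apply: BspaceDZ => //; exact: kspan_Bspace.
  rewrite (_ : cabs 2 = 2); last first.
    by rewrite (_ : 2 = Complex 2 0 :> C) ?cabs_real//; apply: complexP => /=; ring.
  have := mle _ km; have [_] := hg k; have [_] := hg l; rewrite /D.
  move: Nk Nl; move: (k.+1%:R^-1 : R) (l.+1%:R^-1 : R) => ik il.
  set X := sq _; set Y := sq _; set Z := sq _; set W := sq _.
  by move=> *; lra.
have [f0 Bf0 hf0] := complete_sq Bg cg.
suff ff : f = f0 by exists g; split => //; rewrite ff.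
have [_ [f_0 _]] := Bf; have [_ [f0_0 _]] := Bf0.
apply/funext => z; have [Oz|nOz] := pselect (Om z); last by rewrite f_0// f0_0.
have BK := Bspace_K Oz; have kap0 := Knorm_gt0 Oz.
pose kap := KN z ^+ 2; have kp : 0 < kap by rewrite exprn_gt0.
have h1 k : cabs (-1 * g k z + f z) ^+ 2 <= kap * k.+1%:R^-1.
  rewrite (reproducing (Be k) Oz); set c := ip _ _.
  (* The best correction of the error by a multiple of K_z lowers its squared norm by |c|^2 / kap;
     as the corrected error is still at least [m], this gain is at most 1/(k+1). *)
  pose a := - (c / Complex kap 0).
  have kn : Complex kap 0 != 0.
    by apply/negP => /eqP /(congr1 (@complex.Re R)) /= h; rewrite h ltxx in kp.
  have := mle _ (kspanDZ (- a) (kspan_K Oz) (kg k)); rewrite /D.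
  have -> : (fun w => -1 * (- a * K z w + g k w) + f w) =
    fun w => a * K z w + (-1 * g k w + f w) by apply/funext => w; ring.
  rewrite sqnormDZ// sq_K -/kap (inner_conj oOm (Be k) BK) -/c.
  have -> : cabs a ^+ 2 = cabs c ^+ 2 / kap ^+ 2.
    by rewrite cabsN cabsM cabsV cabs_real ?ltW// exprMn exprVn.
  have -> : complex.Re (a * c^*) = - (cabs c ^+ 2 / kap).
    have -> : a * c^* = - ((c * c^*) * Complex (kap^-1) 0).
      rewrite /a (_ : Complex kap^-1 0 = (Complex kap 0)^-1); first by ring.
      apply: (mulfI kn); rewrite divff//.
      by apply: complexP; rewrite !(ReM, ImM)/= ?mulr0 ?mul0r ?subr0 ?addr0// divff// gt_eqF.
    rewrite sqr_cabs; case: (c) => x y.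
    by rewrite !(ReN, ReM, ImM, conjRe, conjIm)/=; ring.
  have [_] := hg k; rewrite /D; move: (k.+1%:R^-1 : R) => ik; set X := sq _ => h2.
  rewrite (_ : _ / _ * kap = cabs c ^+ 2 / kap); last by field; rewrite gt_eqF.
  move=> h3; have : cabs c ^+ 2 / kap <= ik by lra.
  by rewrite ler_pdivrMr// mulrC.
apply/eqP; rewrite -subr_eq0; apply/eqP; apply: cabs_sqr_small_eq0 => e e0.
have e10 : 0 < e / (4 * kap) by rewrite divr_gt0// mulr_gt0.
have [N1 hN1] := invS_small _ e10; have [N2 hN2] := hf0 _ e10.
pose k := maxn N1 N2.
have a1 := hN1 k (leq_maxl _ _); have a2 := hN2 k (leq_maxr _ _).
have Bd : Bs (fun w => -1 * f0 w + g k w) by exact: BspaceDZ.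
have h2 : cabs (-1 * f0 z + g k z) ^+ 2 <= kap * sq (fun w => -1 * f0 w + g k w).
  have := cabs_eval_le Bd Oz.
  rewrite -(@ler_pXn2r _ 2)// ?nnegrE ?mulr_ge0 ?L2norm_ge0 ?cabs_ge0//.
  by rewrite exprMn sqr_L2norm [leRHS]mulrC.
rewrite (_ : f z - f0 z = (-1 * g k z + f z) + (-1 * f0 z + g k z)); last by ring.
apply: (le_trans (cabs_sqrD_le _ _)).
have a1' : kap * k.+1%:R^-1 <= e / 4.
  move: a1; rewrite ltr_pdivlMr ?mulr_gt0//; move: (k.+1%:R^-1 : R) => ik; lra.
have a2' : kap * sq (fun w => -1 * f0 w + g k w) <= e / 4.
  by move: a2; rewrite ltr_pdivlMr ?mulr_gt0//; lra.
by have := h1 k; move: (k.+1%:R^-1 : R) a1' => ik a1'; lra.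
Qed.

(** If g_k in the span tends to f, then T g_k is Cauchy and has a limit F in B(Om). Evaluation at z
    and pairing with [t z] are both continuous, so T g_k (z) = <g_k, t z> passes to the limit. *)
Lemma bounded_extension_in_Bspace (T : (V -> C) -> V -> C) (t : V -> V -> C) (c : R) :
  (forall f g a, ks f -> ks g -> T (fun w => a * f w + g w) = (fun w => a * T f w + T g w)) ->
  (forall f, ks f -> Bs (T f)) ->
  (forall z, Om z -> Bs (t z)) ->
  (forall g z, ks g -> Om z -> T g z = ip g (t z)) ->
  (forall g, ks g -> sq (T g) <= c * sq g) ->
  forall f, Bs f -> exists2 F, Bs F & forall z, Om z -> F z = ip f (t z).
Proof.
move=> Tlin TB tB Tt Tbd f Bf.
have [g [kg gf]] := kspan_dense Bf.
have Bg k : Bs (g k) by exact: kspan_Bspace.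
(* The sign of [c] is unknown, and the tolerances below are divided by the constant. *)
pose c1 := `|c| + 1; have c10 : 0 < c1 by rewrite ltr_wpDl.
have Tbd' h : ks h -> sq (T h) <= c1 * sq h.
  move=> kh; apply: (le_trans (Tbd h kh)); rewrite ler_wpM2r ?sqnorm_ge0//.
  by rewrite (le_trans (ler_norm c))// lerDl.
have cT (e : R) : 0 < e -> exists N, forall k l, (N <= k)%N -> (N <= l)%N ->
     sq (fun w => -1 * T (g l) w + T (g k) w) < e.
  move=> e0; have e10 : 0 < e / (4 * c1) by rewrite divr_gt0// mulr_gt0.
  have [N hN] := gf _ e10; exists N => k l /hN Nk /hN Nl.
  rewrite -(Tlin _ _ (-1) (kg l) (kg k)).
  apply: (le_lt_trans (Tbd' _ (kspanDZ (-1) (kg l) (kg k)))).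
  have -> : (fun w => -1 * g l w + g k w) =
    fun w => 1 * (-1 * (-1 * f w + g l w)) + (-1 * f w + g k w).
    by apply/funext => w; ring.
  have B1 j : Bs (fun w => -1 * f w + g j w) by exact: BspaceDZ.
  have := sqnormD_le (BspaceZ oOm (-1) (B1 l)) (B1 k).
  rewrite sqnormZ// cabsN cabs1 expr1n mul1r.
  move: Nk Nl; rewrite !ltr_pdivlMr ?mulr_gt0//.
  set X := sq _; set Y := sq _; set Z := sq _ => h1 h2 h3.
  by nra.
have [F BF hF] := complete_sq (fun k => TB _ (kg k)) cT.
exists F => // z Oz; apply/eqP; rewrite -subr_eq0; apply/eqP.
apply: cabs_sqr_small_eq0 => e e0.
pose A := KN z ^+ 2 + 1; pose A' := sq (t z) + 1.
have A0 : 0 < A by rewrite ltr_wpDl// sqr_ge0.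
have A'0 : 0 < A' by rewrite ltr_wpDl// sqnorm_ge0.
have e10 : 0 < e / (4 * A) by rewrite divr_gt0// mulr_gt0.
have e20 : 0 < e / (4 * A') by rewrite divr_gt0// mulr_gt0.
have [N1 hN1] := hF _ e10; have [N2 hN2] := gf _ e20.
pose k := maxn N1 N2.
have a1 := hN1 k (leq_maxl _ _); have a2 := hN2 k (leq_maxr _ _).
have B1 : Bs (fun w => -1 * F w + T (g k) w) by apply: BspaceDZ => //; exact: TB.
have B2 : Bs (fun w => -1 * f w + g k w) by exact: BspaceDZ.
have -> : F z - ip f (t z) = - (-1 * F z + T (g k) z) + ip (fun w => -1 * f w + g k w) (t z).
  by rewrite innerDZ ?Tt//; [ring|exact: tB].
apply: (le_trans (cabs_sqrD_le _ _)); rewrite cabsN.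
have := cauchy_schwarz_sqr oOm B2 (tB _ Oz).
have := cauchy_schwarz_sqr oOm B1 (Bspace_K Oz); rewrite -(reproducing B1 Oz) sq_K.
move: a1 a2; rewrite !ltr_pdivlMr ?mulr_gt0// /A /A'.
have := sqnorm_ge0 sigma Om (fun w => -1 * F w + T (g k) w).
have := sqnorm_ge0 sigma Om (fun w => -1 * f w + g k w).
set X := sq _; set Y := sq _; set Z := cabs _ ^+ 2; set W := cabs _ ^+ 2.
by move=> *; nra.
Qed.

End KernelSpan.

(** * Change of variables under a quasi-invariant weighted measure *)

Section ChangeOfVariables.
Import HBNNSimple numFieldNormedType.Exports.
Local Open Scope ereal_scope.
Context (d : measure_display) (T : measurableType d) (R : realType).
Variable mu : {measure set T -> \bar R}.
Variables (Om : set T) (W : T -> R).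
Hypothesis mOm : measurable Om.
Hypothesis mW : measurable_fun Om W.
Hypothesis W0 : forall x, (0 <= W x)%R.

(** The free inner map [g] lets one formula serve both [h] (with the identity) and [h] composed with
    [psi]. *)
Lemma integral_nnsfun_comp_weight (h : {nnsfun T >-> R}) (g : T -> T) :
  measurable_fun Om g ->
  \int[mu]_(x in Om) (h (g x) * W x)%:E =
  \sum_(r \in range h) r%:E * \int[mu]_(x in Om `&` g @^-1` (h @^-1` [set r])) (W x)%:E.
Proof.
move=> mg.
have mA r : measurable (Om `&` g @^-1` (h @^-1` [set r])).
  by apply: mg => //; exact: measurable_sfunP.
have mWr r : measurable_fun Om
    (fun x => ((W \_ (Om `&` g @^-1` (h @^-1` [set r]))) x)%:E).
  apply/measurable_EFinP/measurable_restrict => //.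
  by apply: measurable_funS mW => //; exact: subIsetl.
have W0r r x : (0 <= (W \_ (Om `&` g @^-1` (h @^-1` [set r]))) x)%R.
  by rewrite patchE; case: ifP.
have IE r : \int[mu]_(x in Om) ((W \_ (Om `&` g @^-1` (h @^-1` [set r]))) x)%:E =
    \int[mu]_(x in Om `&` g @^-1` (h @^-1` [set r])) (W x)%:E.
  rewrite -[in RHS](setIidr (@subIsetl _ Om (g @^-1` (h @^-1` [set r])))).
  by rewrite [RHS]integral_mkcondr; apply: eq_integral => x _; rewrite restrict_EFin.
transitivity (\int[mu]_(x in Om)
   \sum_(r \in range h) (r%:E * ((W \_ (Om `&` g @^-1` (h @^-1` [set r]))) x)%:E)).
  apply: eq_integral => x xO; rewrite (fsbigD1 (h (g x)))//=; last by exists (g x).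
  rewrite fsbig1 ?adde0.
    by rewrite patchE mem_set//; split => //; exact: set_mem.
  move=> r [_ /= rn]; rewrite patchE memNset ?mule0// => -[_ /= hr].
  by apply: rn.
rewrite ge0_integral_fsum//.
- apply: eq_fsbigr => r /set_mem [x _ <-]; rewrite ge0_integralZl_EFin ?IE//.
  by move=> y _; rewrite lee_fin.
- by move=> r; apply: measurable_funeM.
- move=> r x Ox; rewrite -EFinM lee_fin; rewrite patchE.
  case: ifPn => [/set_mem[_ /= <-]|_]; last by rewrite mulr0.
  by rewrite mulr_ge0.
Qed.

Variables (psi : T -> T) (c : R).
Hypothesis c0 : (0 <= c)%R.
Hypothesis mpsi : measurable_fun Om psi.
Hypothesis psiOm : forall x, Om x -> Om (psi x).
Hypothesis psiK : forall x, Om x -> psi (psi x) = x.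
Hypothesis quasi : forall E, measurable E -> E `<=` Om ->
  \int[mu]_(x in E) (W x)%:E <= c%:E * \int[mu]_(x in psi @` E) (W x)%:E.

(** An involution is its own inverse; the images in [quasi] thus become the level sets of the
    composed function. *)
Lemma image_involution (A : set T) : psi @` (Om `&` A) = Om `&` psi @^-1` A.
Proof.
apply/seteqP; split=> [_ [x [Ox Ax] <-]|x [Ox Ax]].
  by split; [exact: psiOm|rewrite /= psiK].
by exists (psi x); [split; [exact: psiOm|]|exact: psiK].
Qed.

(** The hypothesis on sets is applied to each level set of a simple function, and monotone
    convergence does the rest. *)
Lemma quasi_invariant_integral (H : T -> R) :
  measurable_fun Om H -> (forall x, (0 <= H x)%R) ->
  \int[mu]_(x in Om) (H x * W x)%:E <= c%:E * \int[mu]_(x in Om) (H (psi x) * W x)%:E.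
Proof.
move=> mH H0.
have mEH : measurable_fun Om (EFin \o H) by exact/measurable_EFinP.
pose h := nnsfun_approx mOm mEH.
have H0' x : Om x -> 0 <= (EFin \o H) x by rewrite /= lee_fin.
have ch x : Om x -> (fun k => (h k x)%:E) @ \oo --> (H x)%:E.
  by move=> Ox; exact: (cvg_nnsfun_approx mOm mEH H0' Ox).
have ndh x : {homo (fun k => h k x) : m k / (m <= k)%N >-> (m <= k)%R}.
  by move=> m k mk; have /lefP := nd_nnsfun_approx mOm mEH mk; exact.
have hH k x : Om x -> (h k x <= H x)%R.
  move=> Ox; rewrite -lee_fin /h nnsfun_approxE.
  exact: (le_approx _ H0').
have step k : \int[mu]_(x in Om) (h k x * W x)%:E <=
    c%:E * \int[mu]_(x in Om) (H (psi x) * W x)%:E.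
  apply: (@le_trans _ _ (c%:E * \int[mu]_(x in Om) (h k (psi x) * W x)%:E)).
    rewrite (integral_nnsfun_comp_weight (h k) (@measurable_id _ _ Om)).
    rewrite (integral_nnsfun_comp_weight (h k) mpsi).
    rewrite ge0_mule_fsumr => [|r].
      apply: lee_fsum => // r [x _ <-].
      rewrite muleCA; apply: lee_wpmul2l; first by rewrite lee_fin.
      rewrite -image_involution; apply: quasi; last exact: subIsetl.
      by apply: measurableI => //; exact: measurable_sfunP.
    (* Distributing [c] over the sum needs non-negative terms; a negative level has an empty
       preimage. *)
    have [r0|r0] := leP 0%R r.
      by apply: mule_ge0; [rewrite lee_fin|apply: integral_ge0 => x _; rewrite lee_fin].
    rewrite preimage_nnfun0// preimage_set0 setI0 integral_set0 mule0//.
  apply: lee_wpmul2l; first by rewrite lee_fin.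
  apply: ge0_le_integral => //.
  - by move=> x Ox; rewrite lee_fin mulr_ge0.
  - apply/measurable_EFinP; apply: measurable_funM => //.
    exact: (measurableT_comp _ mpsi).
  - apply/measurable_EFinP; apply: measurable_funM => //.
    by apply: (measurable_comp mOm _ mH mpsi) => _ [x Ox <-]; exact: psiOm.
  - by move=> x Ox; rewrite lee_fin ler_wpM2r// hH//; exact: psiOm.
have cv : (fun k => \int[mu]_(x in Om) (h k x * W x)%:E) @ \oo -->
    \int[mu]_(x in Om) (H x * W x)%:E.
  have -> : \int[mu]_(x in Om) (H x * W x)%:E =
     \int[mu]_(x in Om) limn (fun k => (h k x * W x)%:E).
    apply: eq_integral => x /set_mem Ox; apply/esym/cvg_lim => //.
    under eq_fun do rewrite EFinM.
    by rewrite EFinM; apply: cvgeZr => //; exact: ch.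
  apply: (@cvg_monotone_convergence _ _ _ mu Om mOm (fun k x => (h k x * W x)%:E)).
  - move=> k; apply/measurable_EFinP; apply: measurable_funM => //.
    exact: measurable_funTS.
  - by move=> k x _; rewrite lee_fin mulr_ge0.
  - by move=> x _ m k mk; rewrite lee_fin ler_wpM2r// ndh.
have /cvg_lim <- := cv; last by [].
apply: lime_le; first by apply/cvg_ex; eexists; exact: cv.
exact: nearW.
Qed.

End ChangeOfVariables.

(** * Schur's test with a weight *)

Section SchurTest.
Local Open Scope ereal_scope.
Context (d : measure_display) (T : measurableType d) (R : realType).
Variable mu : {finite_measure set T -> \bar R}.
Variables (Om : set T) (N : T -> T -> R) (h : T -> R) (A : R).
Hypothesis mOm : measurable Om.
Hypothesis N0 : forall z w, (0 <= N z w)%R.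
Hypothesis mN : measurable_fun (Om `*` Om) (fun x => N x.1 x.2).
Hypothesis h0 : forall z, Om z -> (0 < h z)%R.
Hypothesis mh : measurable_fun Om h.
Hypothesis A0 : (0 < A)%R.
Hypothesis row : forall z, Om z -> \int[mu]_(w in Om) (N z w * h w)%:E <= (A * h z)%:E.
Hypothesis col : forall w, Om w -> \int[mu]_(z in Om) (N z w * h z)%:E <= (A * h w)%:E.

Let mN1 z : Om z -> measurable_fun Om (N z).
Proof.
move=> Oz; apply: (@measurable_comp _ _ _ _ _ _ (Om `*` Om) (fun x => N x.1 x.2) _
  (fun w => (z, w))).
- exact: measurableX.
- by move=> _ [w Ow <-].
- exact: mN.
- by apply: measurable_funTS; exact: pair1_measurable.
Qed.

Let mN2 w : Om w -> measurable_fun Om (N^~ w).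
Proof.
move=> Ow; apply: (@measurable_comp _ _ _ _ _ _ (Om `*` Om) (fun x => N x.1 x.2) _
  (fun z => (z, w))).
- exact: measurableX.
- by move=> _ [z Oz <-].
- exact: mN.
- by apply: measurable_funTS; exact: pair2_measurable.
Qed.

Variables (f g : T -> R).
Hypothesis f0 : forall w, (0 <= f w)%R.
Hypothesis g0 : forall w, (0 <= g w)%R.
Hypothesis mf : measurable_fun Om f.
Hypothesis mg : measurable_fun Om g.
Hypothesis gNf : forall z, Om z -> (g z)%:E <= \int[mu]_(w in Om) (N z w * f w)%:E.

Let mhV : measurable_fun Om (fun w => (h w)^-1)%R.
Proof. exact: measurable_funV_gt0. Qed.

Let G w := (f w ^+ 2 / h w)%R.

Let mG : measurable_fun Om G.
Proof. by apply: measurable_funM => //; exact: measurable_funX. Qed.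

Let G0 w : Om w -> (0 <= G w)%R.
Proof. by move=> Ow; rewrite /G divr_ge0 ?sqr_ge0 ?ltW ?h0. Qed.

(** The integrand for Tonelli; extension by 0 turns iterated integrals over [Om] into integrals over
    the whole space. *)
Let F : T * T -> \bar R :=
  (fun x => (h x.1 * N x.1 x.2 * G x.2)%:E) \_ (Om `*` Om).

Let F0 x : 0 <= F x.
Proof.
rewrite /F patchE; case: ifPn => // /set_mem[/= O1 O2].
by rewrite lee_fin (mulr_ge0 (mulr_ge0 (ltW (h0 O1)) (N0 _ _)) (G0 O2)).
Qed.

Let mF : measurable_fun setT F.
Proof.
apply/(measurable_restrictT _ (measurableX mOm mOm)).
have m1 : measurable_fun (Om `*` Om) (fun x : T * T => h x.1).
  apply: (@measurable_comp _ _ _ _ _ _ Om h _ fst) => //.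
  - by move=> _ [[z w] [Oz Ow] <-].
  - exact: measurable_funTS.
have m2 : measurable_fun (Om `*` Om) (fun x : T * T => G x.2).
  apply: (@measurable_comp _ _ _ _ _ _ Om G _ snd) => //.
  - by move=> _ [[z w] [Oz Ow] <-].
  - exact: measurable_funTS.
by apply/measurable_EFinP; apply: measurable_funM => //; exact: measurable_funM.
Qed.

Let FzE z : Om z -> \int[mu]_w F (z, w) =
  (h z)%:E * \int[mu]_(w in Om) (N z w * G w)%:E.
Proof.
move=> Oz; rewrite -ge0_integralZl_EFin//; last 3 first.
- by move=> w Ow; rewrite lee_fin mulr_ge0 ?G0.
- by apply/measurable_EFinP; apply: measurable_funM => //; exact: mN1.
- by rewrite ltW ?h0.
rewrite [RHS]integral_mkcond; apply: eq_integral => w _.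
rewrite /F !patchE.
have [Ow|nOw] := pselect (Om w); first by rewrite !mem_set//= -EFinM (mulrA (h z)).
by rewrite !memNset// => -[].
Qed.

Let FwE w : Om w -> \int[mu]_z F (z, w) =
  (G w)%:E * \int[mu]_(z in Om) (N z w * h z)%:E.
Proof.
move=> Ow; rewrite -ge0_integralZl_EFin//; last 3 first.
- by move=> z Oz; rewrite lee_fin mulr_ge0// ltW// h0.
- by apply/measurable_EFinP; apply: measurable_funM => //; exact: mN2.
- exact: G0.
rewrite [RHS]integral_mkcond; apply: eq_integral => z _.
rewrite /F !patchE.
have [Oz|nOz] := pselect (Om z).
  by rewrite !mem_set//= -EFinM; congr EFin; ring.
by rewrite !memNset// => -[].
Qed.

Let Fw0 w : ~ Om w -> \int[mu]_z F (z, w) = 0.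
Proof.
move=> nOw; apply: integral0_eq => z _.
by rewrite /F patchE memNset// => -[].
Qed.

(* Cauchy-Schwarz for the weight [N z], in the form
   [2 N f <= N ((g / P) h + (P / g) f^2 / h)] with [P = A h z]. *)
Let pointwise z : Om z -> (g z ^+ 2)%:E <= A%:E * \int[mu]_w F (z, w).
Proof.
move=> Oz; rewrite FzE//; set J := \int[mu]_(w in Om) _.
have J0 : 0 <= J.
  by apply: integral_ge0 => w Ow; rewrite lee_fin mulr_ge0 ?G0.
have [gz0|gzn] := eqVneq (g z) 0%R.
  rewrite gz0 expr0n/=; apply: mule_ge0; first by rewrite lee_fin ltW.
  by apply: mule_ge0 => //; rewrite lee_fin ltW// h0.
have gp : (0 < g z)%R by rewrite lt_def gzn g0.
have hp := h0 Oz.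
pose P := (A * h z)%R; have Pp : (0 < P)%R by rewrite mulr_gt0.
have m1 : measurable_fun Om (fun w => (N z w * h w)%:E).
  by apply/measurable_EFinP; apply: measurable_funM => //; exact: mN1.
have m2 : measurable_fun Om (fun w => (N z w * G w)%:E).
  by apply/measurable_EFinP; apply: measurable_funM => //; exact: mN1.
have p1 w : Om w -> 0 <= (N z w * h w)%:E.
  by move=> Ow; rewrite lee_fin mulr_ge0// ltW// h0.
have p2 w : Om w -> 0 <= (N z w * G w)%:E.
  by move=> Ow; rewrite lee_fin mulr_ge0// G0.
have a0 : (0 <= g z / P / 2)%R by rewrite !divr_ge0// ltW.
have b0 : (0 <= P / g z / 2)%R by rewrite !divr_ge0// ltW.
have : (g z)%:E <= (g z / P / 2)%:E * P%:E + (P / g z / 2)%:E * J.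
  apply: (le_trans (gNf Oz)).
  apply: (@le_trans _ _ (\int[mu]_(w in Om)
     ((g z / P / 2)%:E * (N z w * h w)%:E + (P / g z / 2)%:E * (N z w * G w)%:E))).
    apply: ge0_le_integral => //.
    - by move=> w Ow; rewrite lee_fin mulr_ge0.
    - by apply/measurable_EFinP; apply: measurable_funM => //; exact: mN1.
    - by apply: emeasurable_funD; exact: measurable_funeM.
    - move=> w Ow; rewrite -!EFinM -EFinD lee_fin /G.
      have hw := h0 Ow.
      (* The defect of the inequality is a multiple of the square of g h - P f. *)
      have -> : (g z / P / 2 * (N z w * h w) + P / g z / 2 * (N z w * (f w ^+ 2 / h w)) =
        N z w * f w + N z w / (2 * P * g z * h w) * (g z * h w - P * f w) ^+ 2)%R.
        by field; rewrite !gt_eqF.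
      rewrite lerDl mulr_ge0 ?sqr_ge0// divr_ge0//.
      by rewrite !mulr_ge0// ltW.
  rewrite ge0_integralD//; last 4 first.
  - by move=> w Ow; apply: mule_ge0 => //; exact: p1.
  - exact: measurable_funeM.
  - by move=> w Ow; apply: mule_ge0 => //; exact: p2.
  - exact: measurable_funeM.
  rewrite !ge0_integralZl_EFin//; apply: leeD => //.
  by apply: lee_wpmul2l => //; exact: row.
rewrite -EFinM (_ : (g z / P / 2 * P = g z / 2)%R); last by field; rewrite gt_eqF.
(* Half of [g z] is absorbed on the left, leaving g^2 <= P j; an infinite [J] makes the bound
   trivial. *)
case: J J0 => [j|_|//].
  rewrite lee_fin => j0; rewrite -!EFinM -EFinD !lee_fin => hle.
  have : (g z / 2 <= P / g z / 2 * j)%R by lra.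
  rewrite mulrAC ler_pM2r ?invr_gt0// mulrAC ler_pdivlMr// -expr2.
  by rewrite /P mulrA.
by move=> _; rewrite !gt0_muley ?lte_fin// leey.
Qed.

(** Integrating [pointwise] in z and exchanging the integrals brings in the column bound, whose
    [h w] cancels the denominator of [G w]. One factor [A] comes from [row], the other from
    [col]. *)
Lemma schur_test :
  \int[mu]_(z in Om) (g z ^+ 2)%:E <= (A ^+ 2)%:E * \int[mu]_(w in Om) (f w ^+ 2)%:E.
Proof.
have mFz : measurable_fun setT (fun z => \int[mu]_w F (z, w)).
  exact: (measurable_fun_fubini_tonelli_F F mF F0).
apply: (@le_trans _ _ (\int[mu]_(z in Om) (A%:E * \int[mu]_w F (z, w)))).
  apply: ge0_le_integral => //.
  - by move=> z _; rewrite lee_fin sqr_ge0.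
  - by apply/measurable_EFinP; exact: measurable_funX.
  - by apply: measurable_funeM; exact: measurable_funTS.
rewrite ge0_integralZl_EFin//; last 3 first.
- by move=> z _; apply: integral_ge0 => w _; exact: F0.
- exact: measurable_funTS.
- exact: ltW.
rewrite expr2 EFinM -muleA; apply: lee_wpmul2l; first by rewrite lee_fin ltW.
apply: (@le_trans _ _ (\int[mu]_z \int[mu]_w F (z, w))).
  apply: ge0_subset_integral => // z _.
  by apply: integral_ge0 => w _; exact: F0.
rewrite (sfinite_Fubini mu mu F F0 mF) -ge0_integralZl_EFin//; last 3 first.
- by move=> w _; rewrite lee_fin sqr_ge0.
- by apply/measurable_EFinP; exact: measurable_funX.
- exact: ltW.
rewrite [leRHS]integral_mkcond; apply: ge0_le_integral => //.
- by move=> w _; apply: integral_ge0 => z _; exact: F0.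
- exact: (measurable_fun_fubini_tonelli_G F mF F0).
- apply/(measurable_restrictT _ mOm)/measurable_funeM.
  by apply/measurable_EFinP; exact: measurable_funX.
- move=> w _; rewrite patchE; case: ifPn => [/set_mem Ow|/negP nOw]; last first.
    by rewrite Fw0// => Ow; apply: nOw; rewrite mem_set.
  rewrite FwE//.
  apply: (@le_trans _ _ ((G w)%:E * (A * h w)%:E)).
    by apply: lee_wpmul2l; [rewrite lee_fin G0|exact: col].
  rewrite -!EFinM lee_fin /G le_eqVlt; apply/orP; left; apply/eqP.
  by field; rewrite gt_eqF// h0.
Qed.

End SchurTest.

(** * Hoelder's inequality on a subset *)

Section HoelderOn.
Context (d : measure_display) (T : measurableType d) (R : realType).
Variable mu : {measure set T -> \bar R}.

(** The functions are extended by 0 to use the global inequality; finite bounds [X], [Y] stand for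
    the integrals so that estimates can be inserted directly. *)
Lemma hoelder_on (D : set T) (f g : T -> R) (p q X Y : R) : measurable D ->
  measurable_fun D f -> measurable_fun D g ->
  (forall x, D x -> 0 <= f x) -> (forall x, D x -> 0 <= g x) ->
  0 < p -> 0 < q -> p^-1 + q^-1 = 1 -> 0 <= X -> 0 <= Y ->
  (\int[mu]_(x in D) (f x `^ p)%:E <= X%:E)%E ->
  (\int[mu]_(x in D) (g x `^ q)%:E <= Y%:E)%E ->
  (\int[mu]_(x in D) (f x * g x)%:E <= (X `^ p^-1 * Y `^ q^-1)%:E)%E.
Proof.
move=> mD mf mg f0 g0 p0 q0 pq X0 Y0 hX hY.
pose F x := if x \in D then f x else 0; pose G x := if x \in D then g x else 0.
have mF : measurable_fun setT F by apply/(measurable_restrictT _ mD).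
have mG : measurable_fun setT G by apply/(measurable_restrictT _ mD).
have NE (h : T -> R) (r Z : R) : (forall x, D x -> 0 <= h x) -> 0 < r -> 0 <= Z ->
    (\int[mu]_(x in D) (h x `^ r)%:E <= Z%:E)%E ->
    (Lnorm mu r%:E (EFin \o (fun x => if x \in D then h x else 0%R)) <= (Z `^ r^-1)%:E)%E.
  move=> h0 r0 Z0 hZ; rewrite -poweR_EFin unlock.
  have rV0 : 0 <= r^-1 by rewrite invr_ge0 ltW.
  apply: (gt0_ler_poweR rV0).
  - by rewrite in_itv/= integral_ge0 ?leey// => x _; exact: poweR_ge0.
  - by rewrite in_itv/= lee_fin Z0 leey.
  - move: hZ; rewrite integral_mkcond; congr (_ <= _)%E; apply: eq_integral => x _ /=.
    rewrite patchE; case: ifPn => [/set_mem Dx|_].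
      by rewrite ger0_norm ?h0.
    by rewrite normr0 powR0 ?gt_eqF.
have := hoelder mu mF mG p0 q0 pq; rewrite Lnorm1.
have -> : (\int[mu]_x `|(EFin \o (F \* G)%R) x| = \int[mu]_(x in D) (f x * g x)%:E)%E.
  rewrite [RHS]integral_mkcond; apply: eq_integral => x _ /=.
  rewrite patchE /F /G; case: ifPn => [/set_mem Dx|_].
    by rewrite ger0_norm// mulr_ge0 ?f0 ?g0.
  by rewrite mulr0 normr0.
move=> /le_trans; apply; rewrite EFinM.
by apply: lee_pmul; rewrite ?Lnorm_ge0//; exact: NE.
Qed.

End HoelderOn.

(** * Arithmetic of the exponents *)

Section PowerWeights.
Variable R : realType.
Implicit Types tau x y b c p q beta : R.

(** Turns each identity between products of powers into a linear identity between exponents. *)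
Lemma powR_expR x r : 0 < x -> x `^ r = expR (r * ln x).
Proof. by move=> x0; rewrite /powR gt_eqF. Qed.

(** In these identities x is ||K_w||, y is ||K_z||, b is |<k_z,k_w>|, and tau is the modulus of the
    operator's image of k_z. This one is the p-th power of the first Hoelder factor. *)
Lemma weight_powp tau x b p : 0 <= tau -> 0 < x -> 0 < b -> 0 < p ->
  (tau * (x `^ (2 / p - 1) * b `^ ((2 - p) / p))) `^ p =
  tau `^ p * x `^ (- p) * b `^ (2 - p) * x ^+ 2.
Proof.
move=> t0 x0 b0 p0.
rewrite powRM ?mulr_ge0 ?powR_ge0// -!mulrA; congr (_ * _).
rewrite -(powR_mulrn 2 (ltW x0)) powRM ?powR_ge0// -!powRrM !powR_expR//.
by rewrite -!expRD; congr expR; field; rewrite gt_eqF.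
Qed.

(** The q-th power of the second Hoelder factor is ||K_z||^(-beta) times the Rudin-Forelli
    integrand, as b y x is |<K_z,K_w>|. *)
Lemma weight_powq x y b p q beta : 0 < x -> 0 < y -> 0 < b -> 1 < p -> q = p / (p - 1) ->
  (x `^ (1 - beta / q - 1 + 2 / q) * b `^ ((p - 2) / p)) `^ q =
  y `^ (- beta) * ((b * (y * x)) `^ ((2 - q + beta + (2 - q - beta)) / 2)
    / (y `^ (2 - q - beta) * x `^ (2 - q + beta)) * x ^+ 2).
Proof.
move=> x0 y0 b0 p1 ->; have p0 : 0 < p by exact: lt_trans p1.
have p10 : 0 < p - 1 by rewrite subr_gt0.
rewrite -(powR_mulrn 2 (ltW x0)) powRM ?powR_ge0// -!powRrM [(_ `^ _ * _)^-1]invfM -!powRN.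
rewrite !powR_expR ?mulr_gt0// !lnM ?posrE ?mulr_gt0// -!expRD; congr expR.
by field; rewrite !gt_eqF.
Qed.

(** In the product of the two factors the powers of b cancel. *)
Lemma weight_mul tau x b p q beta : 0 < x -> 0 < b -> 1 < p -> q = p / (p - 1) ->
  tau * (x `^ (2 / p - 1) * b `^ ((2 - p) / p)) *
    (x `^ (1 - beta / q - 1 + 2 / q) * b `^ ((p - 2) / p)) = tau * x `^ (1 - beta / q).
Proof.
move=> x0 b0 p1 ->; have p0 : 0 < p by exact: lt_trans p1.
have p10 : 0 < p - 1 by rewrite subr_gt0.
rewrite -!mulrA; congr (_ * _).
rewrite !powR_expR// -!expRD; congr expR.
by field; rewrite !gt_eqF.
Qed.

(** Here tau is already a p-th power, and b x is |k_z|, so the right side contains |U_z t|^p. *)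
Lemma weight_transl tau x b c p : 0 < x -> 0 < b -> 0 < c ->
  tau * (c * b) `^ p * (c * x) `^ (p - 2) * x ^+ 2 =
  c `^ (2 * p - 2) * (tau * (b * x) `^ p).
Proof.
move=> x0 b0 c0.
rewrite -(powR_mulrn 2 (ltW x0)) !powR_expR ?mulr_gt0// !lnM ?posrE//.
by rewrite mulrCA -!mulrA; congr (_ * _); rewrite -!expRD; congr expR; ring.
Qed.

End PowerWeights.

(** * The weighted integral estimate for one row of the kernel *)

Section KeyEstimate.
Variables (R : realType) (n : nat) (sigma : {measure set (CBorel R n) -> \bar R}).
Variables (Om : set (Cn R n)) (K : Cn R n -> Cn R n -> R[i]).
Variable phi : Cn R n -> Cn R n -> Cn R n.
Hypothesis oOm : Copen Om.
Hypothesis finsig : (sigma setT < +oo)%E.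
Hypothesis RK : reproducing_kernel sigma Om K.
Hypothesis phiP : forall z, Om z ->
     (forall w, Om w -> Om (phi z w)) /\
     (forall w, Om w -> phi z (phi z w) = w) /\
     holo_map_on Om (phi z).
Local Notation C := R[i].
Local Notation V := (Cn R n).
Local Notation B := (CBorel R n).
Local Notation Bs := (Bspace sigma Om).
Local Notation ip := (inner sigma Om).
Local Notation KN := (Knorm sigma Om K).
Local Notation k_ := (nkernel sigma Om K).
Variables c4 c5 : R.
Hypothesis quasi : forall z (E : set V), Om z -> measurable (E : set B) -> E `<=` Om ->
  (lambda sigma Om K E <= c4%:E * lambda sigma Om K (phi z @` E))%E.
Hypothesis A5 : forall z w, Om z -> Om w ->
  (KN (phi z w))^-1 <= c5 * cabs (ip (k_ z) (k_ w)).

Let mOm : measurable (Om : set B). Proof. exact: Copen_measurable. Qed.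

Let KNp z : Om z -> 0 < KN z. Proof. exact: Knorm_gt0. Qed.

(* [KN w] is the supremum of [|f w|] over the unit ball of [Bs], hence lower
   semicontinuous in the Euclidean topology; its continuity for [d] is of no
   help here, as [d]-open sets need not be Borel. *)
Lemma measurable_Knorm : measurable_fun (Om : set B) (KN : B -> R).
Proof.
apply: lsc_measurable => // t.
have [t0|t0] := ltP t 0.
  rewrite (_ : _ `&` _ = Om)//; apply/seteqP; split => [x []//|x Ox].
  by split => //=; apply: lt_trans t0 _; exact: KNp.
move=> z [Oz /= tz].
have [hK _] := Bspace_K RK Oz.
have oU := @Copen_gt R n Om (fun w => cabs (K z w)) (t * KN z) oOm
  (fun w Ow => holo_econt_cabs hK Ow).
have [|e e0 he] := oU z.
  split => //=; rewrite (K_diag oOm RK Oz) cabs_real ?sqr_ge0//.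
  by rewrite expr2 ltr_pM2r ?KNp.
exists e => // y /he[Oy /= ty]; split => //=.
have := cabs_eval_le oOm RK (Bspace_K RK Oz) Oy; rewrite -/(KN z) => h.
by have := lt_le_trans ty h; rewrite mulrC ltr_pM2l ?KNp.
Qed.

(** The quantity |<k_z,k_w>|, written through a value of K_z so that measurability in [w] is
    visible. *)
Definition kcorr z w := cabs (K z w) / (KN z * KN w).

Lemma kcorrE z w : Om z -> Om w -> cabs (ip (k_ z) (k_ w)) = kcorr z w.
Proof.
move=> Oz Ow.
have kE x : k_ x = fun y => (Complex (KN x) 0)^-1 * K x y.
  by apply/funext => y; rewrite mulrC.
have BKz := Bspace_K RK Oz; have BKw := Bspace_K RK Ow.
rewrite !kE innerZl//; last exact: BspaceZ.
rewrite innerZr// !cabsM cabs_conj !cabsV !cabs_real ?ltW ?KNp//.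
rewrite -(reproducing RK BKz Ow) /kcorr invfM mulrA.
by rewrite mulrC mulrA.
Qed.

(** The product of the two is at least 1 / ||K_{phi_z(w)}|| > 0, and [kcorr] is non-negative. This
    is what allows negative powers of it. *)
Lemma kcorr_gt0 z w : Om z -> Om w -> 0 < kcorr z w /\ 0 < c5.
Proof.
move=> Oz Ow; have [ph1 _] := phiP Oz.
have : 0 < (KN (phi z w))^-1 by rewrite invr_gt0 KNp//; exact: ph1.
move=> /lt_le_trans /(_ (A5 Oz Ow)); rewrite kcorrE//.
have b0 : 0 <= kcorr z w by rewrite divr_ge0 ?mulr_ge0 ?cabs_ge0 ?ltW ?KNp.
have [bb|bb] := eqVneq (kcorr z w) 0; first by rewrite bb mulr0 ltxx.
have bp : 0 < kcorr z w by rewrite lt_def bb.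
by rewrite pmulr_lgt0.
Qed.

Lemma cabs_k z w : Om z -> Om w -> cabs (k_ z w) = kcorr z w * KN w.
Proof.
move=> Oz Ow; rewrite /nkernel cabsM cabsV cabs_real ?ltW ?KNp// /kcorr invfM.
by rewrite -!mulrA mulVf ?mulr1// gt_eqF ?KNp.
Qed.

Lemma measurable_kcorr z : Om z -> measurable_fun (Om : set B) (kcorr z : B -> R).
Proof.
move=> Oz; apply: measurable_funM.
  exact: (Bspace_measurable_cabs oOm (Bspace_K RK Oz)).
apply: measurable_funV_gt0; first by move=> x Ox; exact: mulr_gt0 (KNp Oz) (KNp Ox).
by apply: measurable_funM => //; exact: measurable_Knorm.
Qed.

Lemma measurable_phi z : Om z -> measurable_fun (Om : set B) (phi z : B -> B).
Proof.
move=> Oz; have [_ [_ hp]] := phiP Oz.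
apply: (@measurability _ _ B B _ _ (@Copen R n) erefl) => _ [U oU <-].
by apply: Copen_measurable; exact: holo_map_preimage_open.
Qed.

Section Estimate.
Variables p M : R.
Hypothesis p2 : 2 < p.

Let H z t w := cabs (t w) `^ p * KN w `^ (- p) * kcorr z w `^ (2 - p).

(** After the substitution the arguments of [t] and of U_z t agree, and (A.5) trades the weight for
    |k_z|^p. The factor [KN w ^+ 2], the density of lambda, is kept apart from [H] for the
    substitution. *)
Lemma translated_Lp_bound z (t : V -> C) : Om z -> Bs t ->
  (Lnorm sigma p%:E (fun w => (cabs (transl sigma Om K phi z t w))%:E) <= M%:E)%E ->
  (\int[sigma]_(w in (Om : set B)) (H z t w * KN w ^+ 2)%:E <=
    (`|c4| * (c5 `^ (2 * p - 2) * M `^ p))%:E)%E.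
Proof.
move=> Oz Bt hL; have [ph1 [ph2 ph3]] := phiP Oz.
have p0 : 0 < p by apply: lt_trans p2.
have mpow (r : R) (f : B -> R) : measurable_fun (Om : set B) f ->
    measurable_fun (Om : set B) (fun x => f x `^ r).
  by move=> mf; exact: (measurableT_comp (measurable_powR r) mf).
have mKN := measurable_Knorm.
have mH : measurable_fun (Om : set B) (H z t : B -> R).
  apply: measurable_funM; first apply: measurable_funM; apply: mpow => //.
    exact: (Bspace_measurable_cabs oOm Bt).
  exact: measurable_kcorr.
have H0 w : 0 <= H z t w by rewrite !mulr_ge0// powR_ge0.
have quasi' (E : set B) : measurable E -> E `<=` Om ->
  (\int[sigma]_(x in E) (KN x ^+ 2)%:E <=
    `|c4|%:E * \int[sigma]_(x in phi z @` E) (KN x ^+ 2)%:E)%E.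
  move=> mE EO; apply: (le_trans (quasi Oz mE EO)); apply: lee_wpmul2r.
    by apply: integral_ge0 => x _; rewrite lee_fin sqr_ge0.
  by rewrite lee_fin ler_norm.
have := @quasi_invariant_integral _ B R sigma Om (fun x => KN x ^+ 2) mOm
  (measurable_funX 2 mKN) (fun x => sqr_ge0 _) (phi z) `|c4| (normr_ge0 _)
  (measurable_phi Oz) ph1 ph2 quasi' (H z t) mH H0.
move=> /le_trans; apply; rewrite [in leRHS]EFinM.
apply: lee_wpmul2l; first by rewrite lee_fin.
have [_ c5p] := kcorr_gt0 Oz Oz.
have mcomp (f : B -> R) : measurable_fun (Om : set B) f ->
    measurable_fun (Om : set B) (fun w : B => f (phi z w)).
  move=> mf; apply: (measurable_comp mOm _ mf (measurable_phi Oz)).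
  by move=> _ [x Ox <-]; exact: ph1.
have mtr : measurable_fun (Om : set B) (fun w : B => cabs (t (phi z w) * k_ z w)).
  under eq_fun do rewrite cabsM.
  apply: measurable_funM; last first.
    exact: (Bspace_measurable_cabs oOm (Bspace_k oOm RK Oz)).
  exact: (mcomp (fun w => cabs (t w)) (Bspace_measurable_cabs oOm Bt)).
apply: (@le_trans _ _ (\int[sigma]_(w in (Om : set B))
   ((c5 `^ (2 * p - 2))%:E * (cabs (transl sigma Om K phi z t w) `^ p)%:E))%E).
  apply: ge0_le_integral => //.
  - by move=> w Ow; rewrite lee_fin mulr_ge0 ?sqr_ge0.
  - apply/measurable_EFinP; apply: measurable_funM; last exact: measurable_funX.
    exact: (mcomp (H z t) mH).
  - by apply: measurable_funeM; apply/measurable_EFinP; exact: mpow.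
  - move=> u Ou; rewrite -EFinM lee_fin /transl cabsM (cabs_k Oz Ou) /H.
    have Oy := ph1 u Ou; have [b1p _] := kcorr_gt0 Oz Oy; have [b0p _] := kcorr_gt0 Oz Ou.
    have xp := KNp Ou; have yp := KNp Oy.
    (* (A.5) at [u] controls [KN (phi z u)]; at [phi z u], by the involution, it relates
       [kcorr z (phi z u)] to [KN u]. *)
    have := A5 Oz Oy; rewrite kcorrE// ph2//; have := A5 Oz Ou; rewrite kcorrE//.
    move: (kcorr z (phi z u)) (kcorr z u) (KN u) (KN (phi z u)) b1p b0p xp yp.
    move=> b1 b0 x y b1p b0p xp yp h0 h1.
    set tau := cabs _ `^ p; rewrite powRM; [|exact: cabs_ge0|by rewrite mulr_ge0// ltW].
    rewrite -/tau.
    have tau0 : 0 <= tau by exact: powR_ge0.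
    have e1 : y `^ (- p) <= (c5 * b0) `^ p.
      rewrite -[- p]mulN1r powRrM (powR_inv1 (ltW yp)).
      apply: (ge0_ler_powR (ltW p0));
        rewrite ?nnegrE ?invr_ge0 ?mulr_ge0 ?(ltW yp) ?(ltW b0p) ?(ltW c5p)//.
    (* The sign of [p - 2] turns a lower bound on [b1] into an upper bound on [b1] to the power 2 -
       p. *)
    have p20 : 0 <= p - 2 by rewrite subr_ge0 ltW.
    have e2 : b1 `^ (2 - p) <= (c5 * x) `^ (p - 2).
      rewrite (_ : 2 - p = -1 * (p - 2)); last by ring.
      rewrite powRrM (powR_inv1 (ltW b1p)).
      apply: (ge0_ler_powR p20);
        rewrite ?nnegrE ?invr_ge0 ?mulr_ge0 ?(ltW xp) ?(ltW b1p) ?(ltW c5p)//.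
      have h1' : 1 <= c5 * b1 * x by rewrite -ler_pdivrMr// div1r.
      by rewrite -div1r ler_pdivrMr// mulrAC.
    apply: (@le_trans _ _ (tau * (c5 * b0) `^ p * (c5 * x) `^ (p - 2) * x ^+ 2)).
      rewrite ler_wpM2r ?sqr_ge0// ler_pM ?mulr_ge0 ?powR_ge0//.
      by rewrite ler_wpM2l.
    by rewrite weight_transl.
rewrite ge0_integralZl_EFin//; last 3 first.
- by move=> w _; rewrite lee_fin powR_ge0.
- by apply/measurable_EFinP; exact: mpow.
- exact: powR_ge0.
rewrite EFinM; apply: lee_wpmul2l; first by rewrite lee_fin powR_ge0.
rewrite -poweR_EFin.
(* [Lnorm] integrates over the whole space, but k_z vanishes outside [Om]. *)
have -> : (\int[sigma]_(x in (Om : set B)) (cabs (transl sigma Om K phi z t x) `^ p)%:E =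
  Lnorm sigma p%:E (fun w => (cabs (transl sigma Om K phi z t w))%:E) `^ p)%E.
  rewrite (poweR_Lnorm _ _ (lt0r_neq0 p0)) [LHS]integral_mkcond.
  apply: eq_integral => w _.
  rewrite patchE; case: ifPn => [_|/negP nO] /=; first by rewrite ger0_norm ?cabs_ge0.
  have -> : transl sigma Om K phi z t w = 0.
    have [_ [K0 _]] := Bspace_K RK Oz.
    by rewrite /transl /nkernel K0 ?mul0r ?mulr0// => Ow; apply: nO; rewrite mem_set.
  by rewrite cabs0 normr0 powR0 ?gt_eqF.
have M0 : (0 <= M%:E)%E by apply: le_trans hL; exact: Lnorm_ge0.
apply: (gt0_ler_poweR (ltW p0)) => //; rewrite in_itv/= leey andbT//.
exact: Lnorm_ge0.
Qed.

Variables (beta MR : R).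
Let q := p / (p - 1).
Let gam := 2 - q.
Let a := 1 - beta / q.
Hypothesis RF : forall z, Om z ->
  (\int[sigma]_(w in (Om : set B))
    ((cabs (ip (K z) (K w)) `^ ((gam + beta + (gam - beta)) / 2)
       / (KN z `^ (gam - beta) * KN w `^ (gam + beta))) * KN w ^+ 2)%:E <= MR%:E)%E.

(** The p-th root of the translated bound times the q-th root of the Rudin-Forelli bound; absolute
    values are taken because the signs of [c4] and [MR] are not given. *)
Definition schur_const :=
  (`|c4| * (c5 `^ (2 * p - 2) * M `^ p)) `^ p^-1 * `|MR| `^ q^-1.

(** Hoelder's inequality for [F] times [G]: the weight in [F] is the p-th root of the one in
    [translated_Lp_bound], and [G] is what then remains of ||K_w||^a. The q-th root of
    ||K_z||^(-beta) gives the exponent a - 1. *)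
Lemma kernel_row_estimate z (t : V -> C) : Om z -> Bs t ->
  (Lnorm sigma p%:E (fun w => (cabs (transl sigma Om K phi z t w))%:E) <= M%:E)%E ->
  (\int[sigma]_(w in (Om : set B)) (cabs (t w) * KN w `^ a)%:E <=
    (schur_const * KN z `^ (a - 1))%:E)%E.
Proof.
move=> Oz Bt hL.
have p0 : 0 < p by apply: lt_trans p2.
have p1 : 1 < p by apply: lt_trans p2; rewrite ltr1n.
have p10 : 0 < p - 1 by rewrite subr_gt0.
have q0 : 0 < q by rewrite divr_gt0.
have pq : p^-1 + q^-1 = 1 by rewrite /q; field; rewrite !gt_eqF.
have mKN := measurable_Knorm.
have mpow (r : R) (f : B -> R) : measurable_fun (Om : set B) f ->
    measurable_fun (Om : set B) (fun x => f x `^ r).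
  by move=> mf; exact: (measurableT_comp (measurable_powR r) mf).
pose F w := cabs (t w) * (KN w `^ (2 / p - 1) * kcorr z w `^ ((2 - p) / p)).
pose G w := KN w `^ (a - 1 + 2 / q) * kcorr z w `^ ((p - 2) / p).
have mF : measurable_fun (Om : set B) (F : B -> R).
  apply: measurable_funM; first exact: (Bspace_measurable_cabs oOm Bt).
  by apply: measurable_funM; apply: mpow => //; exact: measurable_kcorr.
have mG : measurable_fun (Om : set B) (G : B -> R).
  by apply: measurable_funM; apply: mpow => //; exact: measurable_kcorr.
have F0 w : Om w -> 0 <= F w by move=> _; rewrite !mulr_ge0 ?cabs_ge0 ?powR_ge0.
have G0 w : Om w -> 0 <= G w by move=> _; rewrite !mulr_ge0 ?powR_ge0.
set X := `|c4| * (c5 `^ (2 * p - 2) * M `^ p).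
have X0 : 0 <= X by rewrite !mulr_ge0 ?powR_ge0.
have Zp := KNp Oz.
pose Y := KN z `^ (- beta) * `|MR|.
have Y0 : 0 <= Y by rewrite mulr_ge0 ?powR_ge0.
have hX : (\int[sigma]_(w in (Om : set B)) (F w `^ p)%:E <= X%:E)%E.
  apply: le_trans (translated_Lp_bound Oz Bt hL).
  rewrite (eq_integral (fun w : B => (H z t w * KN w ^+ 2)%:E))// => w /set_mem Ow.
  congr EFin; rewrite /F /H.
  have xp := KNp Ow; have [bp _] := kcorr_gt0 Oz Ow.
  by rewrite weight_powp// cabs_ge0.
have hY : (\int[sigma]_(w in (Om : set B)) (G w `^ q)%:E <= Y%:E)%E.
  have -> : (\int[sigma]_(w in (Om : set B)) (G w `^ q)%:E =
    (KN z `^ (- beta))%:E * \int[sigma]_(w in (Om : set B))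
    ((cabs (ip (K z) (K w)) `^ ((gam + beta + (gam - beta)) / 2)
       / (KN z `^ (gam - beta) * KN w `^ (gam + beta))) * KN w ^+ 2)%:E)%E.
    rewrite -ge0_integralZl_EFin//; last 3 first.
    - move=> w _; rewrite lee_fin; apply: mulr_ge0; last exact: sqr_ge0.
      by apply: divr_ge0; [exact: powR_ge0|apply: mulr_ge0; exact: powR_ge0].
    - apply/measurable_EFinP; apply: measurable_funM; last exact: measurable_funX.
      apply: measurable_funM.
        apply: (mpow _ (fun w : B => cabs (ip (K z) (K w)))).
        apply: (@eq_measurable_fun _ _ _ _ (Om : set B) (fun w : B => cabs (K z w))).
          by move=> w /set_mem Ow; rewrite -(reproducing RK (Bspace_K RK Oz) Ow).
        exact: (Bspace_measurable_cabs oOm (Bspace_K RK Oz)).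
      apply: measurable_funV_gt0.
        by move=> w Ow; apply: mulr_gt0; apply: powR_gt0; exact: KNp.
      by apply: measurable_funM => //; exact: mpow.
    - exact: powR_ge0.
    apply: eq_integral => w /set_mem Ow; rewrite -EFinM; congr EFin.
    rewrite -(reproducing RK (Bspace_K RK Oz) Ow).
    have xp := KNp Ow; have [bp _] := kcorr_gt0 Oz Ow.
    have -> : cabs (K z w) = kcorr z w * (KN z * KN w).
      by rewrite /kcorr divfK// mulf_neq0// gt_eqF.
    exact: weight_powq.
  rewrite /Y EFinM; apply: lee_wpmul2l; first by rewrite lee_fin powR_ge0.
  by apply: (le_trans (RF Oz)); rewrite lee_fin ler_norm.
have := hoelder_on mOm mF mG F0 G0 p0 q0 pq X0 Y0 hX hY.
rewrite (eq_integral (fun w : B => (cabs (t w) * KN w `^ a)%:E)); last first.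
  move=> w /set_mem Ow; congr EFin.
  have xp := KNp Ow; have [bp _] := kcorr_gt0 Oz Ow.
  exact: weight_mul.
move=> /le_trans; apply; rewrite lee_fin /schur_const -/X /Y.
have -> : a - 1 = - beta * q^-1 by rewrite /a; field; rewrite gt_eqF.
by rewrite powRM ?powR_ge0// -powRrM -mulrA (mulrC (`|MR| `^ _)).
Qed.

End Estimate.
End KeyEstimate.

(** Finiteness of sigma is only a hypothesis, whereas Tonelli's theorem is used through the finite
    measure structure; equality of integrals is all that has to be transferred. *)
Lemma finite_measure_of (d : measure_display) (T : measurableType d) (R : realType)
    (mu : {measure set T -> \bar R}) : (mu setT < +oo)%E ->
  exists nu : {finite_measure set T -> \bar R}, forall (D : set T) (f : T -> \bar R),
    (\int[nu]_(x in D) f x = \int[mu]_(x in D) f x)%E.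
Proof.
move=> muT.
have fmu : fin_num_fun mu.
  move=> A mA; rewrite ge0_fin_numE//; apply: le_lt_trans muT.
  by apply: le_measure; rewrite ?inE.
have sfmu : sigma_finite setT mu.
  by apply: fin_num_fun_sigma_finite => //; rewrite measure0.
pose H1 := isFinite.Build _ _ _ _ fmu.
pose H2 := isSFinite.Build _ _ _ _ (sfinite_measure_sigma_finite sfmu).
pose H3 := isSigmaFinite.Build _ _ _ _ sfmu.
pose nu := HB.pack_for (FiniteMeasure.type T R) (Measure.sort mu) H1 H2 H3.
by exists nu => D f; exact: eq_measure_integral.
Qed.

(** * The operator, its adjoint kernel and the bounded extension *)

Section Operator.
Variables (R : realType) (n : nat) (sigma : {measure set (CBorel R n) -> \bar R}).
Variables (Om : set (Cn R n)) (K : Cn R n -> Cn R n -> R[i]).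
Variable phi : Cn R n -> Cn R n -> Cn R n.
Hypothesis oOm : Copen Om.
Hypothesis finsig : (sigma setT < +oo)%E.
Hypothesis RK : reproducing_kernel sigma Om K.
Hypothesis Bc : Bcomplete sigma Om.
Hypothesis phiP : forall z, Om z ->
     (forall w, Om w -> Om (phi z w)) /\
     (forall w, Om w -> phi z (phi z w) = w) /\
     holo_map_on Om (phi z).
Local Notation C := R[i].
Local Notation V := (Cn R n).
Local Notation B := (CBorel R n).
Local Notation Bs := (Bspace sigma Om).
Local Notation ip := (inner sigma Om).
Local Notation KN := (Knorm sigma Om K).
Local Notation k_ := (nkernel sigma Om K).
Local Notation ks := (kspan sigma Om K).
Local Notation sq := (sqnorm sigma Om).
Variables c4 c5 : R.
Hypothesis quasi : forall z (E : set V), Om z -> measurable (E : set B) -> E `<=` Om ->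
  (lambda sigma Om K E <= c4%:E * lambda sigma Om K (phi z @` E))%E.
Hypothesis A5 : forall z w, Om z -> Om w ->
  (KN (phi z w))^-1 <= c5 * cabs (ip (k_ z) (k_ w)).
Variables p beta MR : R.
Hypothesis p2 : 2 < p.
Hypothesis RF : forall z, Om z ->
  (\int[sigma]_(w in (Om : set B))
    ((cabs (ip (K z) (K w)) `^ ((2 - p / (p - 1) + beta + (2 - p / (p - 1) - beta)) / 2)
       / (KN z `^ (2 - p / (p - 1) - beta) * KN w `^ (2 - p / (p - 1) + beta)))
       * KN w ^+ 2)%:E <= MR%:E)%E.

Definition linear_on_kspan (S : (V -> C) -> V -> C) := forall f g a, ks f -> ks g ->
  S (fun w => a * f w + g w) = (fun w => a * S f w + S g w).

Lemma linear_on_kspan0 S : linear_on_kspan S -> S (fun=> 0) = fun=> 0.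
Proof.
move=> lS; have k0 := kspan0 sigma Om K.
have := lS _ _ 1 k0 k0.
rewrite (_ : (fun w : V => 1 * 0 + 0) = fun=> 0); last first.
  by apply/funext => w; rewrite mulr0 addr0.
move=> h; apply/funext => w; have := congr1 (@^~ w) h; rewrite /= mul1r.
by rewrite -{1}[S _ w]addr0 => /addrI <-.
Qed.

Lemma linear_on_kspanZ S a f : linear_on_kspan S -> ks f ->
  S (fun w => a * f w) = fun w => a * S f w.
Proof.
move=> lS kf; have := lS f _ a kf (kspan0 sigma Om K).
rewrite linear_on_kspan0// => h.
rewrite (_ : (fun w => a * f w) = fun w => a * f w + 0).
  by rewrite h; apply/funext => w; rewrite addr0.
by apply/funext => w; rewrite addr0.
Qed.

Lemma linear_on_kspan_K S z : linear_on_kspan S -> Om z ->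
  S (K z) = fun w => Complex (KN z) 0 * S (k_ z) w.
Proof.
move=> lS Oz; rewrite (KE oOm finsig RK Oz) linear_on_kspanZ//.
exact: kspan_k.
Qed.

Variables T Tstar : (V -> C) -> V -> C.
Hypothesis lT : linear_on_kspan T.
Hypothesis lTs : linear_on_kspan Tstar.
Hypothesis BT : forall f, ks f -> Bs (T f).
Hypothesis BTs : forall f, ks f -> Bs (Tstar f).
Hypothesis adj : forall z w, Om z -> Om w -> ip (T (k_ z)) (k_ w) = ip (k_ z) (Tstar (k_ w)).

Let kK z : Om z -> ks (K z). Proof. exact: kspan_K. Qed.

(** Duality is given on pairs of kernels; the reproducing property makes T g (z) a pairing with K_z,
    and linearity in g extends it to the span. *)
Lemma kspan_adjoint g z : ks g -> Om z -> T g z = ip g (Tstar (K z)).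
Proof.
move=> kg Oz; have BtK := BTs (kK Oz); move: g kg; apply: kspan_ind.
  by rewrite linear_on_kspan0// inner0l.
move=> a x f Ox kf IH; have kx : ks (k_ x) by exact: kspan_k.
have Bkx := Bspace_k oOm RK Ox; have Bkz := Bspace_k oOm RK Oz.
rewrite lT// IH innerDZ//; last exact: (kspan_Bspace oOm RK kf).
congr (_ * _ + _).
rewrite (reproducing RK (BT kx) Oz) {1}(KE oOm finsig RK Oz).
rewrite linear_on_kspan_K// (innerZr oOm _ Bkz (BT kx)) adj//.
by rewrite (innerZr oOm _ _ Bkx)//; apply: BTs; exact: kspan_k.
Qed.

(** Used twice: column integrals become row integrals for [T], and for fixed [w] the kernel is the
    modulus of a holomorphic function of [z], hence continuous. *)
Lemma cabs_adjoint_kernel z w : Om z -> Om w ->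
  cabs (Tstar (K z) w) = cabs (T (K w) z).
Proof.
move=> Oz Ow; rewrite (kspan_adjoint (kK Ow) Oz).
have BtK := BTs (kK Oz); have BKw := Bspace_K RK Ow.
by rewrite (inner_conj oOm BtK BKw) cabs_conj -(reproducing RK BtK Ow).
Qed.

Variables M1 M2 : R.
Hypothesis LT : forall z, Om z -> (Lnorm sigma p%:E
  (fun w => (cabs (transl sigma Om K phi z (T (k_ z)) w))%:E) <= M1%:E)%E.
Hypothesis LTs : forall z, Om z -> (Lnorm sigma p%:E
  (fun w => (cabs (transl sigma Om K phi z (Tstar (k_ z)) w))%:E) <= M2%:E)%E.

Let a := 1 - beta / (p / (p - 1)).
(** One positive constant dominating both row constants; the added 1 makes it strictly positive. *)
Definition op_bound :=
  schur_const c4 c5 p M1 MR + schur_const c4 c5 p M2 MR + 1.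

Let schur_const_ge0 M : 0 <= schur_const c4 c5 p M MR.
Proof. by rewrite /schur_const mulr_ge0 ?powR_ge0. Qed.

Let op_bound_gt0 : 0 < op_bound.
Proof. exact: ltr_wpDl (addr_ge0 (schur_const_ge0 M1) (schur_const_ge0 M2)) ltr01. Qed.

Let schur_const_le1 : schur_const c4 c5 p M1 MR <= op_bound.
Proof.
move: (schur_const_ge0 M1) (schur_const_ge0 M2); rewrite /op_bound.
by move: (schur_const c4 c5 p M1 MR) (schur_const c4 c5 p M2 MR) => x y; lra.
Qed.

Let schur_const_le2 : schur_const c4 c5 p M2 MR <= op_bound.
Proof.
move: (schur_const_ge0 M1) (schur_const_ge0 M2); rewrite /op_bound.
by move: (schur_const c4 c5 p M1 MR) (schur_const c4 c5 p M2 MR) => x y; lra.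
Qed.

(** Passing from k_z to K_z multiplies by ||K_z||, which raises the exponent a - 1 to a and
    reproduces the Schur weight. A generic [S] serves both [T] and [Tstar]. *)
Let row_bound S M z : linear_on_kspan S -> (forall f, ks f -> Bs (S f)) ->
  schur_const c4 c5 p M MR <= op_bound -> Om z ->
  (Lnorm sigma p%:E (fun w => (cabs (transl sigma Om K phi z (S (k_ z)) w))%:E) <= M%:E)%E ->
  (\int[sigma]_(w in (Om : set B)) (cabs (S (K z) w) * KN w `^ a)%:E <=
    (op_bound * KN z `^ a)%:E)%E.
Proof.
move=> lS BS hM Oz hL; have Zp := Knorm_gt0 oOm finsig RK Oz.
have kz : ks (k_ z) by exact: kspan_k.
rewrite linear_on_kspan_K//.
under eq_integral do rewrite cabsM cabs_real ?(ltW Zp)// -mulrA EFinM.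
rewrite ge0_integralZl_EFin ?(ltW Zp)//; last 3 first.
- exact: Copen_measurable.
- by move=> w _; rewrite lee_fin mulr_ge0 ?cabs_ge0 ?powR_ge0.
- apply/measurable_EFinP; apply: measurable_funM.
    exact: (Bspace_measurable_cabs oOm (BS _ kz)).
  exact: (measurableT_comp (measurable_powR a) (measurable_Knorm oOm finsig RK)).
have Z0 : (0 <= (KN z)%:E)%E by rewrite lee_fin ltW.
have := lee_wpmul2l Z0
  (kernel_row_estimate oOm finsig RK phiP quasi A5 p2 RF Oz (BS _ kz) hL).
move=> /le_trans; apply; rewrite -EFinM lee_fin mulrCA.
have -> : KN z * KN z `^ (1 - beta / (p / (p - 1)) - 1) = KN z `^ a.
  rewrite -{1}(powRr1 (ltW Zp)) -powRD; last by apply/implyP => _; rewrite gt_eqF.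
  by rewrite addrC subrK.
by rewrite ler_wpM2r// powR_ge0.
Qed.

(** Taking [F] as a given member of B(Om) allows two uses: with T g for g in the span, before any
    extension exists, and with the extension itself. *)
Lemma integral_operator_bound f F : Bs f -> Bs F ->
  (forall z, Om z -> F z = ip f (Tstar (K z))) -> sq F <= op_bound ^+ 2 * sq f.
Proof.
move=> Bf BF FE; have [mu muE] := finite_measure_of finsig.
have mOm := Copen_measurable oOm.
have KNp := Knorm_gt0 oOm finsig RK.
have mKNa : measurable_fun (Om : set B) (fun w : B => KN w `^ a).
  exact: (measurableT_comp (measurable_powR a) (measurable_Knorm oOm finsig RK)).
have := @schur_test _ B R mu Om (fun z w => cabs (Tstar (K z) w)) (fun w => KN w `^ a)
  op_bound mOm (fun z w => cabs_ge0 _) _ (fun z Oz => powR_gt0 a (KNp z Oz)) mKNa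
  op_bound_gt0 _ _ (fun w => cabs (f w)) (fun w => cabs (F w))
  (fun w => cabs_ge0 _) (fun w => cabs_ge0 _)
  (Bspace_measurable_cabs oOm Bf) (Bspace_measurable_cabs oOm BF) _.
move=> schur.
have h : (\int[sigma]_(z in (Om : set B)) (cabs (F z) ^+ 2)%:E <=
   (op_bound ^+ 2)%:E * \int[sigma]_(w in (Om : set B)) (cabs (f w) ^+ 2)%:E)%E.
  rewrite -!muE; apply: schur.
  - apply: (@separately_continuous_measurable R n Om
      (fun z w => cabs (Tstar (K z) w)) oOm).
      by move=> z Oz; exact: (Bspace_measurable_cabs oOm (BTs (kK Oz))).
    move=> z w Oz Ow e e0.
    have [hT _] := BT (kK Ow).
    have [e1 e10 he1] := oOm Oz; have [dl dl0 hdl] := holo_econt_cabs hT Oz e0.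
    exists (Num.min e1 dl); first by rewrite lt_min e10.
    move=> y; rewrite lt_min => /andP[/he1 Oy /hdl].
    by rewrite /= !cabs_adjoint_kernel.
  - move=> z Oz; rewrite muE; exact: row_bound lTs BTs schur_const_le2 Oz (LTs Oz).
  - move=> w Ow; rewrite muE.
    rewrite (eq_integral (fun z : B => (cabs (T (K w) z) * KN z `^ a)%:E)).
      exact: row_bound lT BT schur_const_le1 Ow (LT Ow).
    by move=> z /set_mem Oz; rewrite cabs_adjoint_kernel.
  - move=> z Oz; rewrite muE FE//; under eq_integral do rewrite mulrC.
    exact: (cabs_inner_le_integral oOm Bf (BTs (kK Oz))).
have [_ [_ fi]] := Bf; have [_ [_ Fi]] := BF.
have fin (g : V -> C) : (\int[sigma]_(x in (Om : set B)) (cabs (g x) ^+ 2)%:E < +oo)%E ->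
    (\int[sigma]_(x in (Om : set B)) (cabs (g x) ^+ 2)%:E)%E = (sq g)%:E.
  move=> gi; rewrite /sqnorm fineK// ge0_fin_numE//.
  by apply: integral_ge0 => x _; rewrite lee_fin sqr_ge0.
by move: h; rewrite (fin _ fi) (fin _ Fi) -EFinM lee_fin.
Qed.

(** Defining [S] by the pairing makes linearity and agreement with [T] immediate; [ext] is called
    only for membership in B(Om). *)
Theorem bounded_extension : exists S : (V -> C) -> (V -> C),
    (forall f, Bs f -> Bs (S f)) /\
    (forall f g (a : C), Bs f -> Bs g ->
       S (fun w => a * f w + g w) = (fun w => a * S f w + S g w)) /\
    (exists c : R, forall f, Bs f ->
       L2norm sigma Om (S f) <= c * L2norm sigma Om f) /\
    (forall f, ks f -> S f = T f).
Proof.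
have BtK z : Om z -> Bs (Tstar (K z)) by move=> Oz; exact: BTs (kK Oz).
have Tbd g : ks g -> sq (T g) <= op_bound ^+ 2 * sq g.
  move=> kg; apply: integral_operator_bound.
  - exact: (kspan_Bspace oOm RK kg).
  - exact: BT.
  - by move=> z Oz; exact: kspan_adjoint.
have ext := bounded_extension_in_Bspace oOm finsig RK Bc lT BT BtK kspan_adjoint Tbd.
(* Elements of [Bspace] vanish outside [Om], and [S] must equal [T] as a function. *)
pose S (f : V -> C) z := if z \in Om then ip f (Tstar (K z)) else 0.
have SE f z : Om z -> S f z = ip f (Tstar (K z)) by move=> Oz; rewrite /S mem_set.
have S0 f z : ~ Om z -> S f z = 0 by move=> Oz; rewrite /S memNset.
have SB f : Bs f -> Bs (S f).
  move=> Bf; have [F BF FE] := ext f Bf; rewrite (_ : S f = F)//.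
  apply/funext => z; have [Oz|nOz] := pselect (Om z); first by rewrite SE// FE.
  by have [_ [F0 _]] := BF; rewrite S0// F0.
exists S; split => //; split; last split.
- move=> f g b Bf Bg; apply/funext => z.
  have [Oz|nOz] := pselect (Om z); last by rewrite !S0// mulr0 addr0.
  by rewrite !SE// innerDZ//; exact: BtK.
- exists op_bound => f Bf.
  rewrite -(@ler_pXn2r _ 2)// ?nnegrE ?mulr_ge0 ?L2norm_ge0 ?(ltW op_bound_gt0)//.
  rewrite exprMn !sqr_L2norm; apply: integral_operator_bound => //.
    exact: SB.
  by move=> z Oz; rewrite SE.
- move=> f kf; apply/funext => z; have [Oz|nOz] := pselect (Om z).
    by rewrite SE// kspan_adjoint.
  by have [_ [T0 _]] := BT kf; rewrite S0// T0.
Qed.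

End Operator.

(* The exponents [gam + beta] and [gam - beta] straddle a positive [kappa];
   [kappa / 2 < gam] is what the lower bound on [p] provides. *)
Lemma exists_rudin_forelli_shift (R : realType) (kappa gam : R) (P : R -> R -> Prop) :
  0 <= kappa -> kappa / 2 < gam ->
  (0 < kappa -> forall r s, kappa < r -> 0 < s -> s < kappa -> P r s) ->
  (kappa = 0 -> forall r, 0 < r -> P r r) ->
  exists beta, P (gam + beta) (gam - beta).
Proof.
move=> k0 kg Ppos Pzero.
have [k00|kn] := eqVneq kappa 0.
  exists 0; rewrite addr0 subr0; apply: Pzero => //.
  by move: kg; rewrite k00 mul0r.
have kp : 0 < kappa by rewrite lt_def kn.
(* Admissibility reads m < beta < gam, and the midpoint is taken. *)
pose m := Num.max (kappa - gam) (gam - kappa).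
have m1 : kappa - gam <= m by rewrite le_max lexx.
have m2 : gam - kappa <= m by rewrite le_max lexx orbT.
have mg : m < gam by rewrite gt_max; apply/andP; split; lra.
by exists ((m + gam) / 2); apply: Ppos => //; lra.
Qed.

Theorem theorem3p1 (R : realType) (n : nat) (Om : set (Cn R n))
  (phi : Cn R n -> Cn R n -> Cn R n) (d : Cn R n -> Cn R n -> R)
  (sigma : {measure set CBorel R n -> \bar R}) (K : Cn R n -> Cn R n -> R[i])
  (kappa : R)
  (T Tstar : (Cn R n -> R[i]) -> (Cn R n -> R[i])) (p : R) :
  bergman_type Om phi d sigma K kappa ->
  (* T and T^* are linear operators on span{k_z} with values in B(Om) *)
  (forall f g (a : R[i]), kspan sigma Om K f -> kspan sigma Om K g ->
     T (fun w => a * f w + g w) = (fun w => a * T f w + T g w)) ->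
  (forall f g (a : R[i]), kspan sigma Om K f -> kspan sigma Om K g ->
     Tstar (fun w => a * f w + g w) = (fun w => a * Tstar f w + Tstar g w)) ->
  (forall f, kspan sigma Om K f -> Bspace sigma Om (T f)) ->
  (forall f, kspan sigma Om K f -> Bspace sigma Om (Tstar f)) ->
  (* <T k_z, k_w> = <k_z, T^* k_w> *)
  (forall z w, Om z -> Om w ->
     inner sigma Om (T (nkernel sigma Om K z)) (nkernel sigma Om K w) =
     inner sigma Om (nkernel sigma Om K z) (Tstar (nkernel sigma Om K w))) ->
  (4 - kappa) / (2 - kappa) < p ->
  (exists M : R, forall z, Om z ->
     (Lnorm sigma p%:E (fun w => (cabs (transl sigma Om K phi z
        (T (nkernel sigma Om K z)) w))%:E) <= M%:E)%E) ->
  (exists M : R, forall z, Om z ->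
     (Lnorm sigma p%:E (fun w => (cabs (transl sigma Om K phi z
        (Tstar (nkernel sigma Om K z)) w))%:E) <= M%:E)%E) ->
  (* T extends to a bounded operator on B(Om) *)
  exists S : (Cn R n -> R[i]) -> (Cn R n -> R[i]),
    (forall f, Bspace sigma Om f -> Bspace sigma Om (S f)) /\
    (forall f g (a : R[i]), Bspace sigma Om f -> Bspace sigma Om g ->
       S (fun w => a * f w + g w) = (fun w => a * S f w + S g w)) /\
    (exists c : R, forall f, Bspace sigma Om f ->
       L2norm sigma Om (S f) <= c * L2norm sigma Om f) /\
    (forall f, kspan sigma Om K f -> S f = T f).
Proof.
move=> [[oOm _] [_ [phiA [_ [_ [_ [_ [_ [finsig [RK [Bc [_ [[c4 A4] [_ [[c5 A5]
  [kap0 [kap2 [[RFpos RFzero] _]]]]]]]]]]]]]]]]]].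
move=> lT lTs BT BTs adj hp [M1 LT] [M2 LTs].
have phiP z : Om z -> (forall w, Om w -> Om (phi z w)) /\
    (forall w, Om w -> phi z (phi z w) = w) /\ holo_map_on Om (phi z).
  by move=> /phiA[? [? [? _]]].
have k20 : 0 < 2 - kappa by rewrite subr_gt0.
have hp' : 4 - kappa < p * (2 - kappa) by rewrite -ltr_pdivrMr.
(* For kappa >= 0 the threshold (4 - kappa) / (2 - kappa) is at least 2. *)
have p2 : 2 < p by nra.
have p10 : 0 < p - 1 by lra.
(* Cleared of denominators, this is [hp'] rearranged. *)
have kg : kappa / 2 < 2 - p / (p - 1).
  rewrite (_ : 2 - p / (p - 1) = (p - 2) / (p - 1)); last by field; rewrite gt_eqF.
  by rewrite ltr_pdivlMr//; nra.
have [beta [MR RF]] := exists_rudin_forelli_shift kap0 kg RFpos RFzero.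
apply: (@bounded_extension R n sigma Om K phi oOm finsig RK Bc phiP c4 c5
  _ _ p beta MR p2 RF T Tstar lT lTs BT BTs adj M1 M2 LT LTs).
- by move=> z E Oz mE EO; have [] := A4 z E Oz mE EO.
- by move=> z w Oz Ow; have [] := A5 z w Oz Ow.
Qed.
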